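(* Let $\mathcal{O}$ be a polynomial ring over a field $k$ of characteristic zero and $\mathfrak{h}\subset\mathfrak{g}$ ideals of $\mathcal{O}$. Assume that $\mathfrak{h}$ is unmixed, that $\mathfrak{g}$ is a radical complete intersection ideal, and that the Jacobian ideal $\mathcal{J}(\mathfrak{h})$ of $\mathfrak{h}$ is not contained in any minimal prime of $\mathcal{O}/\mathfrak{g}$. Let $M:=\mathfrak{g}/(\mathfrak{g}^2+\mathfrak{h})$. Suppose there exist a minimal generating set $\{g_1,\ldots,g_n\}$ of $\mathfrak{g}$ and an integer $t$ with $0\le t\le n$ such that: (1) the images of $g_1,\ldots,g_t$ in $M$ are contained in $T(M)$; (2) for every prime $\mathfrak{p}\in\operatorname{Ass}(\mathcal{O}/\mathfrak{g})$, the images of $g_{t+1},\ldots,g_n$ in $(\mathcal{O}/\mathfrak{h})_{\bar{\mathfrak{p}}}$ generate $(\mathfrak{g}/\mathfrak{h})_{\bar{\mathfrak{p}}}$ as a complete intersection ideal of $(\mathcal{O}/\mathfrak{h})_{\bar{\mathfrak{p}}}$. Then $$\int_{\mathfrak{h}}\mathfrak{g}=(g_1,\ldots,g_t)+(g_{t+1},\ldots,g_n)^2 .$$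
   Context: A complete intersection ideal is an ideal generated by a regular sequence; condition (2) means the listed images generate the ideal and form a regular sequence. $\bar{\mathfrak{p}}=\mathfrak{p}/\mathfrak{h}$ denotes the image of $\mathfrak{p}$ in $\mathcal{O}/\mathfrak{h}$, and a subscript $\bar{\mathfrak{p}}$ denotes localization. Let $\operatorname{Der}(\mathcal{O})$ be the module of $k$-derivations of $\mathcal{O}$ and $\operatorname{Der}_{\mathfrak{h}}(\mathcal{O})=\{\xi\in\operatorname{Der}(\mathcal{O}) : \xi(\mathfrak{h})\subset\mathfrak{h}\}$. The primitive ideal of $\mathfrak{g}$ relative to $\mathfrak{h}$ is $\int_{\mathfrak{h}}\mathfrak{g}=\{f\in\mathfrak{g} : \xi(f)\in\mathfrak{g}\text{ for all }\xi\in\operatorname{Der}_{\mathfrak{h}}(\mathcal{O})\}$. An ideal is unmixed if all its associated primes have the same height. The Jacobian ideal $\mathcal{J}(\mathfrak{h})$ is generated by $\mathfrak{h}$ and the $p\times p$ minors of the Jacobian matrix of a generating set of $\mathfrak{h}$, $p$ being the height (grade) of $\mathfrak{h}$. A ''minimal prime of $\mathcal{O}/\mathfrak{g}$'' means a prime of $\mathcal{O}$ minimal over $\mathfrak{g}$. $M$ is an $\mathcal{O}/\mathfrak{g}$-module and $T(M)$ is its torsion part: the kernel of $M\to M\otimes Q$, where $Q$ is the total quotient ring of $\mathcal{O}/\mathfrak{g}$ (i.e. the elements killed by some non-zero divisor of $\mathcal{O}/\mathfrak{g}$). *)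

(* Defs.v *)
From HB Require Import structures.
From mathcomp Require Import all_boot all_order all_algebra.
From mathcomp Require Import ring_quotient generic_quotient.
From mathcomp Require Import boolp.
From mathcomp Require Import ring.
From mathcomp.multinomials Require Import mpoly.

Set Implicit Arguments.
Unset Strict Implicit.
Unset Printing Implicit Defensive.

Import GRing.Theory.
Local Open Scope ring_scope.
Local Open Scope quotient_scope.

(* Unlike [idealr] of ring_quotient, the unit ideal is allowed, and the ring may
   be trivial. Membership is boolean through excluded middle ([asbool]). *)
HB.mixin Record isAbsorbing (R : comPzRingType) (S : R -> bool) := {
  ideal_absorb : forall a, {in S, forall u, a * u \in S}
}.

#[short(type="ideal")]
HB.structure Definition Ideal (R : comPzRingType) :=
  {S of GRing.ZmodClosed R S & isAbsorbing R S}.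

HB.factory Record isIdeal (R : comPzRingType) (S : R -> bool) := {
  ideal_zero : 0 \in S;
  ideal_add_closed : {in S &, forall u v, u + v \in S};
  ideal_mul_closed : forall a, {in S, forall u, a * u \in S}
}.

HB.builders Context R S of isIdeal R S.
Fact zmod_closed_subproof : zmod_closed S.
Proof.
split=> [|u v uS vS]; first exact: ideal_zero.
by rewrite -mulN1r; apply/ideal_add_closed/ideal_mul_closed.
Qed.
HB.instance Definition _ := GRing.isZmodClosed.Build R S zmod_closed_subproof.
HB.instance Definition _ := isAbsorbing.Build R S ideal_mul_closed.
HB.end.

Section Ideals.
Variable R : comPzRingType.
Implicit Types (I J P Q : ideal R) (x y : R) (s : seq R).

Definition ideal_span (A : R -> Prop) : {pred R} :=
  fun x => `[< forall I : ideal R, (forall a, A a -> a \in I) -> x \in I >].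

Fact ideal_span_zero A : 0 \in ideal_span A.
Proof. by apply/asboolP => I _; apply: rpred0. Qed.
Fact ideal_span_add A : {in ideal_span A &, forall u v, u + v \in ideal_span A}.
Proof.
move=> u v /asboolP uA /asboolP vA; apply/asboolP => I AI.
by apply: rpredD; [apply: uA | apply: vA].
Qed.
Fact ideal_span_mul A a : {in ideal_span A, forall u, a * u \in ideal_span A}.
Proof.
by move=> u /asboolP uA; apply/asboolP => I AI; apply/ideal_absorb/uA.
Qed.
HB.instance Definition _ A := isIdeal.Build R (ideal_span A)
  (@ideal_span_zero A) (@ideal_span_add A) (@ideal_span_mul A).

Definition ideal_gen s : ideal R := ideal_span (fun x => x \in s).

Definition ideal_prod I J : ideal R :=
  ideal_span (fun x => exists u v, [/\ u \in I, v \in J & x = u * v]).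

Definition ideal_sum I J : {pred R} :=
  fun x => `[< exists u v, [/\ u \in I, v \in J & x = u + v] >].

Fact ideal_sum_zero I J : 0 \in ideal_sum I J.
Proof. by apply/asboolP; exists 0, 0; rewrite !rpred0 addr0. Qed.
Fact ideal_sum_add I J :
  {in ideal_sum I J &, forall u v, u + v \in ideal_sum I J}.
Proof.
move=> _ _ /asboolP[a [b [aI bJ ->]]] /asboolP[c [d [cI dJ ->]]].
by apply/asboolP; exists (a + c), (b + d); rewrite !rpredD // addrACA.
Qed.
Fact ideal_sum_mul I J a : {in ideal_sum I J, forall u, a * u \in ideal_sum I J}.
Proof.
move=> _ /asboolP[b [c [bI cJ ->]]]; apply/asboolP.
by exists (a * b), (a * c); rewrite !ideal_absorb // mulrDr.
Qed.
HB.instance Definition _ I J := isIdeal.Build R (ideal_sum I J)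
  (@ideal_sum_zero I J) (@ideal_sum_add I J) (@ideal_sum_mul I J).

Definition radical_ideal I := forall x n, x ^+ n \in I -> x \in I.

Definition prime_ideal P :=
  1 \notin P /\ forall x y, x * y \in P -> (x \in P) || (y \in P).

Definition minimal_prime I P :=
  [/\ prime_ideal P, {subset I <= P} &
      forall Q, prime_ideal Q -> {subset I <= Q} -> {subset Q <= P} -> Q =i P].

Definition prime_chain (c : nat -> ideal R) n P :=
  [/\ forall i, (i <= n)%N -> prime_ideal (c i),
      forall i, (i < n)%N -> {subset c i <= c i.+1} /\ ~ (c i =i c i.+1) &
      c n =i P].

(* As a relation: it holds for no [n] when [P] has infinite height. *)
Definition prime_height P n :=
  (exists c, prime_chain c n P) /\ ~ (exists c, prime_chain c n.+1 P).

Definition ideal_height I n :=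
  (exists P, [/\ prime_ideal P, {subset I <= P} & prime_height P n]) /\
  (forall P m, prime_ideal P -> {subset I <= P} -> prime_height P m ->
     (n <= m)%N).

Definition nonzerodivisor x := forall y, x * y = 0 -> y = 0.

Definition generating_set s I := ideal_gen s =i I.

(* Minimality is with respect to inclusion. *)
Definition minimal_generating_set s I :=
  [/\ uniq s, generating_set s I &
      forall s', {subset s' <= s} -> generating_set s' I -> {subset s <= s'}].

Lemma minimal_generating_set_sub s I :
  minimal_generating_set s I -> {subset s <= I}.
Proof. by case=> _ sI _ x xs; rewrite -sI; apply/asboolP => J; apply. Qed.

End Ideals.

Section QuotientRing.
Variables (R : comPzRingType) (I : ideal R).

Definition quot_ring := Quotient.quot I.
HB.instance Definition _ := GRing.Zmodule.on quot_ring.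

Definition qproj (x : R) : quot_ring := \pi_(Quotient.quot I) x.

Lemma qprojP x y : reflect (qproj x = qproj y) (x - y \in I).
Proof.
by rewrite (_ : (x - y \in I) = (qproj x == qproj y)) ?Quotient.idealrBE;
  [apply: eqP|].
Qed.

Lemma qprojK (a : quot_ring) : qproj (repr a) = a.
Proof. exact: reprK. Qed.

Fact qproj_is_zmod_morphism : zmod_morphism qproj.
Proof. exact: pi_is_zmod_morphism. Qed.
HB.instance Definition _ :=
  GRing.isZmodMorphism.Build R quot_ring qproj qproj_is_zmod_morphism.

Definition quot_mul (a b : quot_ring) := qproj (repr a * repr b).

Lemma quot_mulE x y : quot_mul (qproj x) (qproj y) = qproj (x * y).
Proof.
apply/qprojP; set x' := repr _; set y' := repr _.
have xI : x' - x \in I by apply/qprojP; rewrite qprojK.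
have yI : y' - y \in I by apply/qprojP; rewrite qprojK.
rewrite (_ : _ - _ = y' * (x' - x) + x * (y' - y)); last by ring.
by rewrite rpredD // ideal_absorb.
Qed.

Fact quot_mulA : associative quot_mul.
Proof.
by move=> a b c; rewrite -[a]qprojK -[b]qprojK -[c]qprojK !quot_mulE mulrA.
Qed.
Fact quot_mulC : commutative quot_mul.
Proof. by move=> a b; rewrite -[a]qprojK -[b]qprojK !quot_mulE mulrC. Qed.
Fact quot_mul1 : left_id (qproj 1) quot_mul.
Proof. by move=> a; rewrite -[a]qprojK !quot_mulE mul1r. Qed.
Fact quot_mulDl : left_distributive quot_mul +%R.
Proof.
move=> a b c; rewrite -[a]qprojK -[b]qprojK -[c]qprojK.
by rewrite -raddfD !quot_mulE -raddfD mulrDl.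
Qed.
HB.instance Definition _ := GRing.Zmodule_isComPzRing.Build quot_ring
  quot_mulA quot_mulC quot_mul1 quot_mulDl.

Fact qproj_is_monoid_morphism : monoid_morphism qproj.
Proof. by split=> // x y; rewrite -quot_mulE. Qed.
HB.instance Definition _ :=
  GRing.isMonoidMorphism.Build R quot_ring qproj qproj_is_monoid_morphism.

(* The ideal [J/I] of [R/I], i.e. the image of [J] (only used for [I <= J]). *)
Definition quot_ideal (J : ideal R) : {pred quot_ring} :=
  fun a => `[< exists2 x, x \in J & a = qproj x >].

Fact quot_ideal_zero J : 0 \in quot_ideal J.
Proof. by apply/asboolP; exists 0; rewrite ?rpred0 ?raddf0. Qed.
Fact quot_ideal_add J :
  {in quot_ideal J &, forall u v, u + v \in quot_ideal J}.
Proof.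
move=> _ _ /asboolP[x xJ ->] /asboolP[y yJ ->]; apply/asboolP.
by exists (x + y); rewrite ?rpredD ?raddfD.
Qed.
Fact quot_ideal_mul J a : {in quot_ideal J, forall u, a * u \in quot_ideal J}.
Proof.
move=> _ /asboolP[x xJ ->]; apply/asboolP; exists (repr a * x).
  exact: ideal_absorb.
by rewrite rmorphM /= qprojK.
Qed.
HB.instance Definition _ J := isIdeal.Build quot_ring (quot_ideal J)
  (@quot_ideal_zero J) (@quot_ideal_add J) (@quot_ideal_mul J).

End QuotientRing.

Arguments quot_ideal {R} I J.

Section PrimesAndSequences.
Variable R : comPzRingType.
Implicit Types (I P Q : ideal R) (s : seq R).

(* [P] belongs to Ass(R/I): it is prime and is the annihilator of an element. *)
Definition associated_prime I P :=
  prime_ideal P /\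
  exists m : quot_ring I, forall x, x \in P <-> qproj I x * m = 0.

Definition unmixed I :=
  forall P Q n, associated_prime I P -> associated_prime I Q ->
    prime_height P n -> prime_height Q n.

Definition regular_sequence s :=
  (forall i, (i < size s)%N ->
     nonzerodivisor (qproj (ideal_gen (take i s)) s`_i)) /\
  1 \notin ideal_gen s.

Definition complete_intersection I :=
  exists2 s, regular_sequence s & generating_set s I.

End PrimesAndSequences.

(* [localization S] inverts the multiplicative submonoid generated by [S]; for
   the complement of a prime ideal, [S] is already a submonoid. *)
Section Localization.
Variables (R : comPzRingType) (S : R -> Prop).

Definition denominator (x : R) : Prop :=
  exists2 s : seq R, (forall y, y \in s -> S y) & x = \prod_(y <- s) y.

Lemma denominator1 : denominator 1.
Proof. by exists [::]; rewrite ?big_nil. Qed.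
Lemma denominatorM x y : denominator x -> denominator y -> denominator (x * y).
Proof.
move=> [s Ss ->] [t St ->]; exists (s ++ t); last by rewrite big_cat.
by move=> z; rewrite mem_cat => /orP[/Ss|/St].
Qed.

Definition fraction := {x : R * R | `[< denominator x.2 >]}.
Definition num (x : fraction) : R := (val x).1.
Definition den (x : fraction) : R := (val x).2.
Lemma denP x : denominator (den x). Proof. exact/asboolP/(valP x). Qed.
Definition frac a s (Ss : denominator s) : fraction :=
  exist _ (a, s) (asboolT Ss).

Definition frac_equiv (x y : fraction) :=
  `[< exists2 u, denominator u & u * (num x * den y - num y * den x) = 0 >].

Fact frac_equiv_class : equiv_class_of frac_equiv.
Proof.
split=> [x|x y|y x z].
- by apply/asboolP; exists 1; [exact: denominator1 | rewrite subrr mulr0].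
- by apply/asboolP/asboolP => -[u Su ux]; exists u => //;
    rewrite -opprB mulrN ux oppr0.
move=> /asboolP[u Su uxy] /asboolP[v Sv vyz]; apply/asboolP.
exists (u * v * den y); first by do !apply: denominatorM => //; apply: denP.
transitivity (v * den z * (u * (num x * den y - num y * den x)) +
              u * den x * (v * (num y * den z - num z * den y))); first by ring.
by rewrite uxy vyz !mulr0 addr0.
Qed.
Canonical frac_equiv_equiv := EquivRelPack frac_equiv_class.
Canonical frac_equiv_encModRel := defaultEncModRel frac_equiv.

Definition localization := {eq_quot frac_equiv}.
HB.instance Definition _ := Choice.on localization.
HB.instance Definition _ := EqQuotient.on localization.

Definition loc_frac a s (Ss : denominator s) : localization :=
  \pi_localization (frac a Ss).

Lemma loc_fracP a s Ss b t St :
  @loc_frac a s Ss = @loc_frac b t St <->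
  exists2 u, denominator u & u * (a * t - b * s) = 0.
Proof.
have E : (@loc_frac a s Ss == @loc_frac b t St)
       = frac_equiv (frac a Ss) (frac b St) by rewrite /loc_frac piE.
by split=> [/eqP|H]; [rewrite E => /asboolP | apply/eqP; rewrite E; apply/asboolP].
Qed.

Lemma loc_fracW (P : localization -> Prop) :
  (forall a s Ss, P (@loc_frac a s Ss)) -> forall z, P z.
Proof.
move=> PP z; rewrite -[z]reprK; case: (repr z) => -[a s] /= p.
have -> : exist _ (a, s) p = frac a (asboolW p) by apply: val_inj.
exact: PP.
Qed.

Lemma loc_frac_repr z :
  z = loc_frac (num (repr z)) (denP (repr z)).
Proof.
rewrite -[LHS]reprK; congr (\pi _); apply: val_inj.
by rewrite /num /den /=; case: (val _).
Qed.

Definition loc_zero := loc_frac 0 denominator1.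
Definition loc_one := loc_frac 1 denominator1.
Definition loc_opp (z : localization) :=
  loc_frac (- num (repr z)) (denP (repr z)).
Definition loc_add (z w : localization) :=
  loc_frac (num (repr z) * den (repr w) + num (repr w) * den (repr z))
           (denominatorM (denP (repr z)) (denP (repr w))).
Definition loc_mul (z w : localization) :=
  loc_frac (num (repr z) * num (repr w))
           (denominatorM (denP (repr z)) (denP (repr w))).

Lemma loc_frac_reprP a s Ss (z := repr (@loc_frac a s Ss)) :
  exists2 u, denominator u & u * (num z * s - a * den z) = 0.
Proof.
exact: (loc_fracP (num z) (denP z) a Ss).1 (esym (loc_frac_repr _)).
Qed.

Lemma loc_oppE a s Ss : loc_opp (@loc_frac a s Ss) = loc_frac (- a) Ss.
Proof.
have [u Su e] := loc_frac_reprP a Ss; apply/loc_fracP; exists u => //.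
by rewrite !mulNr opprK addrC -opprB mulrN e oppr0.
Qed.

Lemma loc_addE a s Ss b t St :
  loc_add (@loc_frac a s Ss) (@loc_frac b t St) =
  loc_frac (a * t + b * s) (denominatorM Ss St).
Proof.
have [u Su e] := loc_frac_reprP a Ss; have [v Sv f] := loc_frac_reprP b St.
apply/loc_fracP; exists (u * v); first exact: denominatorM.
move: (repr (loc_frac a Ss)) (repr (loc_frac b St)) e f => x y e f.
transitivity (v * t * den y * (u * (num x * s - a * den x)) +
  u * s * den x * (v * (num y * t - b * den y))); first by ring.
by rewrite e f !mulr0 addr0.
Qed.

Lemma loc_mulE a s Ss b t St :
  loc_mul (@loc_frac a s Ss) (@loc_frac b t St) =
  loc_frac (a * b) (denominatorM Ss St).
Proof.
have [u Su e] := loc_frac_reprP a Ss; have [v Sv f] := loc_frac_reprP b St.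
apply/loc_fracP; exists (u * v); first exact: denominatorM.
move: (repr (loc_frac a Ss)) (repr (loc_frac b St)) e f => x y e f.
transitivity (v * num y * t * (u * (num x * s - a * den x)) +
  u * a * den x * (v * (num y * t - b * den y))); first by ring.
by rewrite e f !mulr0 addr0.
Qed.

Lemma loc_frac_eq a s Ss b t St :
  a * t = b * s -> @loc_frac a s Ss = @loc_frac b t St.
Proof.
move=> e; apply/loc_fracP; exists 1; first exact: denominator1.
by rewrite e subrr mulr0.
Qed.

Fact loc_addA : associative loc_add.
Proof.
elim/loc_fracW=> a s Ss; elim/loc_fracW=> b t St; elim/loc_fracW=> c r Sr.
by rewrite !loc_addE; apply: loc_frac_eq; ring.
Qed.
Fact loc_addC : commutative loc_add.
Proof.
elim/loc_fracW=> a s Ss; elim/loc_fracW=> b t St.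
by rewrite !loc_addE; apply: loc_frac_eq; ring.
Qed.
Fact loc_add0 : left_id loc_zero loc_add.
Proof.
by elim/loc_fracW=> a s Ss; rewrite !loc_addE; apply: loc_frac_eq; ring.
Qed.
Fact loc_addN : left_inverse loc_zero loc_opp loc_add.
Proof.
elim/loc_fracW=> a s Ss; rewrite loc_oppE !loc_addE.
by apply: loc_frac_eq; ring.
Qed.
HB.instance Definition _ := GRing.isZmodule.Build localization
  loc_addA loc_addC loc_add0 loc_addN.

Fact loc_mulA : associative loc_mul.
Proof.
elim/loc_fracW=> a s Ss; elim/loc_fracW=> b t St; elim/loc_fracW=> c r Sr.
by rewrite !loc_mulE; apply: loc_frac_eq; ring.
Qed.
Fact loc_mulC : commutative loc_mul.
Proof.
elim/loc_fracW=> a s Ss; elim/loc_fracW=> b t St.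
by rewrite !loc_mulE; apply: loc_frac_eq; ring.
Qed.
Fact loc_mul1 : left_id loc_one loc_mul.
Proof.
by elim/loc_fracW=> a s Ss; rewrite !loc_mulE; apply: loc_frac_eq; ring.
Qed.
Fact loc_mulDl : left_distributive loc_mul loc_add.
Proof.
elim/loc_fracW=> a s Ss; elim/loc_fracW=> b t St; elim/loc_fracW=> c r Sr.
by rewrite loc_addE !loc_mulE loc_addE; apply: loc_frac_eq; ring.
Qed.
HB.instance Definition _ := GRing.Zmodule_isComPzRing.Build localization
  loc_mulA loc_mulC loc_mul1 loc_mulDl.

Definition loc_map (a : R) : localization := loc_frac a denominator1.

Definition loc_ideal (J : ideal R) : {pred localization} :=
  fun z => `[< exists a s (Ss : denominator s), a \in J /\ z = loc_frac a Ss >].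

Fact loc_ideal_zero J : 0 \in loc_ideal J.
Proof.
by apply/asboolP; exists 0, 1, denominator1; rewrite rpred0.
Qed.
Fact loc_ideal_add J : {in loc_ideal J &, forall u v, u + v \in loc_ideal J}.
Proof.
move=> _ _ /asboolP[a [s [Ss [aJ ->]]]] /asboolP[b [t [St [bJ ->]]]].
apply/asboolP; exists (a * t + b * s), (s * t), (denominatorM Ss St).
by split; [rewrite rpredD // mulrC ideal_absorb | exact: loc_addE].
Qed.
Fact loc_ideal_mul J w : {in loc_ideal J, forall u, w * u \in loc_ideal J}.
Proof.
move=> _ /asboolP[a [s [Ss [aJ ->]]]]; elim/loc_fracW: w => b t St.
apply/asboolP; exists (b * a), (t * s), (denominatorM St Ss).
by split; [exact: ideal_absorb | exact: loc_mulE].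
Qed.
HB.instance Definition _ J := isIdeal.Build localization (loc_ideal J)
  (@loc_ideal_zero J) (@loc_ideal_add J) (@loc_ideal_mul J).

End Localization.

Arguments loc_map {R} S a.
Arguments loc_ideal {R} S J.

Notation loc_at P := (localization (fun x => x \notin P)).
Notation loc_map_at P := (loc_map (fun x => x \notin P)).
Notation loc_ideal_at P J := (loc_ideal (fun x => x \notin P) J).

Definition torsion (A : comPzRingType) (V : lmodType A) (v : V) : Prop :=
  exists2 a : A, nonzerodivisor a & a *: v = 0.

(* g/(g^2+h) as a module over R/g; its elements are those of the ideal
   g/(g^2+h) of the ring R/(g^2+h) (only used for h <= g). *)
Section Conormal.
Variables (R : comPzRingType) (h g : ideal R).

Definition conormal_denom : ideal R := ideal_sum (ideal_prod g g) h.
Local Notation N := conormal_denom.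

Definition conormal := {a : quot_ring N | a \in quot_ideal N g}.
HB.instance Definition _ := [isSub of conormal for @sval _ _].
HB.instance Definition _ := [Choice of conormal by <:].
HB.instance Definition _ := [SubChoice_isSubZmodule of conormal by <:].

Lemma conormal_actE (a : R) (v : conormal) :
  qproj N (repr (qproj g a)) * val v = qproj N a * val v.
Proof.
case: v => _ /= /asboolP[x xg ->]; rewrite -!rmorphM /=; apply/qprojP.
rewrite -mulrBl; apply/asboolP; exists ((repr (qproj g a) - a) * x), 0.
split; rewrite ?rpred0 ?addr0 //; apply/asboolP => I; apply.
by exists (repr (qproj g a) - a), x; split=> //; apply/qprojP; rewrite qprojK.
Qed.

Definition conormal_scale (a : quot_ring g) (v : conormal) : conormal :=
  exist _ (qproj N (repr a) * val v) (ideal_absorb (qproj N (repr a)) _ (valP v)).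

Lemma val_conormal_scale (a : R) (v : conormal) :
  val (conormal_scale (qproj g a) v) = qproj N a * val v.
Proof. exact: conormal_actE. Qed.

Fact conormal_scaleA a b v :
  conormal_scale a (conormal_scale b v) = conormal_scale (a * b) v.
Proof.
apply: val_inj; rewrite -[a]qprojK -[b]qprojK -rmorphM.
by rewrite !val_conormal_scale mulrA -rmorphM.
Qed.
Fact conormal_scale1 : left_id 1 conormal_scale.
Proof.
move=> v; apply: val_inj; rewrite -(rmorph1 (qproj g)) val_conormal_scale.
by rewrite rmorph1 mul1r.
Qed.
Fact conormal_scaleDr : right_distributive conormal_scale +%R.
Proof. by move=> a v w; apply: val_inj; rewrite /= mulrDr. Qed.
Fact conormal_scaleDl v : {morph conormal_scale^~ v : a b / a + b}.
Proof.
move=> a b; have -> : a + b = qproj g (repr a + repr b).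
  by rewrite raddfD /= !qprojK.
by apply: val_inj; rewrite val_conormal_scale rmorphD mulrDl.
Qed.
HB.instance Definition _ := GRing.Zmodule_isLmodule.Build
  (quot_ring g) conormal conormal_scaleA conormal_scale1 conormal_scaleDr
  conormal_scaleDl.

Fact conormal_class_subproof x : x \in g -> qproj N x \in quot_ideal N g.
Proof. by move=> xg; apply/asboolP; exists x. Qed.
Definition conormal_class x (xg : x \in g) : conormal :=
  exist _ (qproj N x) (conormal_class_subproof xg).

End Conormal.

Section PolynomialRing.
Variables (k : fieldType) (m : nat).
Local Notation O := {mpoly k[m]}.
Implicit Types (h g : ideal O).

Definition jacobian_mx (fs : seq O) : 'M[O]_(size fs, m) :=
  \matrix_(i, j) (fs`_i)^`M(j).

Definition minor_of p a b (A : 'M[O]_(a, b)) (x : O) : Prop :=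
  exists (r : 'I_p -> 'I_a) (c : 'I_p -> 'I_b),
    [/\ {homo r : i j / (i < j)%N}, {homo c : i j / (i < j)%N} &
        x = \det (mxsub r c A)].

(* The Jacobian ideal does not depend on the chosen generating set; hence it is
   given by a relation rather than by a choice of generators. *)
Definition is_jacobian_ideal h (J : ideal O) :=
  exists p fs, [/\ ideal_height h p, generating_set fs h &
    J =i ideal_span (fun x => x \in h \/ minor_of p (jacobian_mx fs) x)].

(* k-linearity is part of the type of [xi]. *)
Definition derivation (xi : {linear O -> O}) :=
  forall a b, xi (a * b) = a * xi b + b * xi a.

Definition derivation_along h (xi : {linear O -> O}) :=
  derivation xi /\ forall a, a \in h -> xi a \in h.

Definition primitive_ideal h g : {pred O} :=
  fun f => `[< f \in g /\ forall xi, derivation_along h xi -> xi f \in g >].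

Fact primitive_ideal_zero h g : 0 \in primitive_ideal h g.
Proof. by apply/asboolP; split=> [|xi _]; rewrite ?raddf0 rpred0. Qed.
Fact primitive_ideal_add h g :
  {in primitive_ideal h g &, forall u v, u + v \in primitive_ideal h g}.
Proof.
move=> u v /asboolP[ug uD] /asboolP[vg vD]; apply/asboolP.
by split=> [|xi xiD]; rewrite ?raddfD rpredD //; [exact: uD | exact: vD].
Qed.
Fact primitive_ideal_mul h g a :
  {in primitive_ideal h g, forall u, a * u \in primitive_ideal h g}.
Proof.
move=> u /asboolP[ug uD]; apply/asboolP; split=> [|xi xiD].
  exact: ideal_absorb.
rewrite xiD.1 rpredD //; first by rewrite ideal_absorb // uD.
by rewrite mulrC ideal_absorb.
Qed.
HB.instance Definition _ h g := isIdeal.Build O (primitive_ideal h g)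
  (@primitive_ideal_zero h g) (@primitive_ideal_add h g)
  (@primitive_ideal_mul h g).

End PolynomialRing.

(* Main.v *)
Require Import Defs.
From HB Require Import structures.
From mathcomp Require Import all_boot all_order all_algebra.
From mathcomp Require Import boolp.
From mathcomp Require Import ring.
From mathcomp.multinomials Require Import mpoly.

Set Implicit Arguments.
Unset Strict Implicit.
Unset Printing Implicit Defensive.

Import Order.Theory GRing.Theory.
Local Open Scope ring_scope.

(* An element of the primitive ideal is, modulo [(g_1, ..., g_t)], of the form
   [f = sum_j a_j g_(t+j)], and it suffices that every [a_j] lies in every
   associated prime [P] of the radical ideal [g]. Locally at [P], the [g_(t+j)]
   are a regular sequence generating the maximal ideal of [O/h]. In
   characteristic zero, an element of [P] whose partial derivatives all lie in
   [P] belongs to [P^2] locally at [P]. Elimination turns the partial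
   derivatives into derivations [th_j] that annihilate some [f_1, ..., f_p] in
   [h], map [h] to [P], and are such that an element of [P] sent to [P] by every
   [th_j] belongs to [(f_1, ..., f_p) + P^2] locally at [P]. Nakayama's lemma
   along the regular sequence then gives [h = (f_1, ..., f_p)] locally, so a
   multiple of each [th_j] by an element outside [P] preserves [h]. Hence
   [th_j f] lies in [P] for all [j], so [f] is in [h + P^2] locally, and
   quasi-regularity of the [g_(t+j)] puts the [a_j] in [P]. *)

(** * Ideals localized at a prime *)

Section IdealTheory.
Variable R : comPzRingType.
Implicit Types (I J K P : ideal R) (x y : R) (s : seq R).

(** [ideal_span] is an intersection of ideals, so induction on it amounts to packing the predicate
    [p] itself as an ideal. *)
Lemma ideal_span_ind (A p : R -> Prop) :
  p 0 -> (forall x y, p x -> p y -> p (x + y)) ->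
  (forall a x, p x -> p (a * x)) -> (forall a, A a -> p a) ->
  forall x, x \in ideal_span A -> p x.
Proof.
move=> p0 pD pM pA x /asboolP xA.
pose S : {pred R} := fun y => `[< p y >].
have S0 : 0 \in S by apply/asboolP.
have SD : {in S &, forall u v, u + v \in S}.
  by move=> u v /asboolP ? /asboolP ?; apply/asboolP/pD.
have SM a : {in S, forall u, a * u \in S}.
  by move=> u /asboolP ?; apply/asboolP/pM.
pose I : ideal R := HB.pack S (isIdeal.Build R S S0 SD SM).
by have /asboolP : x \in I by apply: xA => a /pA ?; apply/asboolP.
Qed.

Lemma ideal_span_sub (A : R -> Prop) I :
  (forall a, A a -> a \in I) -> {subset ideal_span A <= I}.
Proof. by move=> AI x /asboolP; apply. Qed.

Lemma mem_ideal_span (A : R -> Prop) x : A x -> x \in ideal_span A.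
Proof. by move=> Ax; apply/asboolP => I; apply. Qed.

Lemma ideal_absorbr I a : {in I, forall u, u * a \in I}.
Proof. by move=> u uI; rewrite mulrC ideal_absorb. Qed.

Lemma ideal_gen_sub s I : {subset s <= I} -> {subset ideal_gen s <= I}.
Proof. exact: ideal_span_sub. Qed.

Lemma mem_ideal_gen s : {subset s <= ideal_gen s}.
Proof. by move=> x; apply: mem_ideal_span. Qed.

Lemma mem_ideal_prod I J x y : x \in I -> y \in J -> x * y \in ideal_prod I J.
Proof. by move=> xI yJ; apply: mem_ideal_span; exists x, y. Qed.

Lemma ideal_prod_sub I J K :
  (forall x y, x \in I -> y \in J -> x * y \in K) ->
  {subset ideal_prod I J <= K}.
Proof.
by move=> IJK; apply: ideal_span_sub => _ [x [y [xI yJ ->]]]; apply: IJK.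
Qed.

Lemma mem_ideal_suml I J : {subset I <= ideal_sum I J}.
Proof. by move=> x xI; apply/asboolP; exists x, 0; rewrite rpred0 addr0. Qed.

Lemma mem_ideal_sumr I J : {subset J <= ideal_sum I J}.
Proof. by move=> x xI; apply/asboolP; exists 0, x; rewrite rpred0 add0r. Qed.

Lemma ideal_sum_sub I J K :
  {subset I <= K} -> {subset J <= K} -> {subset ideal_sum I J <= K}.
Proof.
by move=> IK JK _ /asboolP[x [y [/IK xK /JK yK ->]]]; apply: rpredD.
Qed.

Lemma ideal_genP s x :
  reflect (exists c : nat -> R, x = \sum_(i < size s) c i * s`_i)
          (x \in ideal_gen s).
Proof.
apply: (iffP idP) => [|[c ->]]; last first.
  apply: rpred_sum => i _; apply: ideal_absorb.
  by apply: mem_ideal_gen; apply: mem_nth.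
move: x; apply: ideal_span_ind => [|_ _ [c ->] [d ->]|a _ [c ->]|a a_s].
- by exists (fun=> 0); rewrite big1 // => i _; rewrite mul0r.
- exists (fun i => c i + d i); rewrite -big_split /=.
  by apply: eq_bigr => i _; rewrite mulrDl.
- exists (fun i => a * c i); rewrite mulr_sumr.
  by apply: eq_bigr => i _; rewrite mulrA.
have ia : (index a s < size s)%N by rewrite index_mem.
exists (fun i => (i == index a s)%:R).
rewrite (bigD1 (Ordinal ia)) //= eqxx mul1r nth_index // big1 ?addr0 //.
by move=> i /negPf; rewrite -val_eqE /= => ->; rewrite mul0r.
Qed.

Lemma ideal_prod_genP I s x : x \in ideal_prod I (ideal_gen s) ->
  exists2 c : nat -> R, (forall i, c i \in I) &
    x = \sum_(i < size s) c i * s`_i.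
Proof.
move: x; apply: ideal_span_ind => [|_ _ [c cI ->] [d dI ->]|a _ [c cI ->]|].
- by exists (fun=> 0); [rewrite rpred0 | rewrite big1 // => i _; rewrite mul0r].
- exists (fun i => c i + d i) => [i|]; first by rewrite rpredD.
  by rewrite -big_split; apply: eq_bigr => i _; rewrite mulrDl.
- exists (fun i => a * c i) => [i|]; first exact: ideal_absorb.
  by rewrite mulr_sumr; apply: eq_bigr => i _; rewrite mulrA.
move=> _ [u [_ [uI /ideal_genP[c ->] ->]]].
exists (fun i => c i * u) => [i|]; first exact: ideal_absorb.
by rewrite mulr_sumr; apply: eq_bigr => i _; rewrite mulrCA mulrA.
Qed.

Lemma prime_ideal_denom P x : prime_ideal P ->
  denominator (fun y => y \notin P) x -> x \notin P.
Proof.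
move=> [P1 PM] [s sP ->]; elim: s sP => [|y s IHs] sP; first by rewrite big_nil.
rewrite big_cons; apply/negP => /PM/orP[]; first exact/negP/sP/mem_head.
by apply/negP/IHs => z zs; apply: sP; rewrite inE zs orbT.
Qed.

Lemma denominator_mem (S : R -> Prop) x : S x -> denominator S x.
Proof.
by move=> Sx; exists [:: x]; rewrite ?big_seq1 // => y /[!inE]/eqP->.
Qed.

(* The contraction to [R] of the extension of [I] to the localization at [P]. *)
Definition sat P I : {pred R} :=
  fun x => `[< exists2 d, denominator (fun y => y \notin P) d & d * x \in I >].

Fact sat_zero P I : 0 \in sat P I.
Proof.
by apply/asboolP; exists 1; rewrite ?mulr0 ?rpred0 //; apply: denominator1.
Qed.
Fact sat_add P I : {in sat P I &, forall u v, u + v \in sat P I}.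
Proof.
move=> u v /asboolP[d dP du] /asboolP[e eP ev]; apply/asboolP.
exists (d * e); first exact: denominatorM.
have -> : d * e * (u + v) = e * (d * u) + d * (e * v) by ring.
by rewrite rpredD // ideal_absorb.
Qed.
Fact sat_mul P I a : {in sat P I, forall u, a * u \in sat P I}.
Proof.
move=> u /asboolP[d dP du]; apply/asboolP; exists d => //.
by rewrite mulrCA ideal_absorb.
Qed.
HB.instance Definition _ P I := isIdeal.Build R (sat P I)
  (@sat_zero P I) (@sat_add P I) (@sat_mul P I).

Lemma sat_intro P I d x : d \notin P -> d * x \in I -> x \in sat P I.
Proof.
by move=> dP dxI; apply/asboolP; exists d => //; apply: denominator_mem.
Qed.

Lemma mem_satP P I x : prime_ideal P ->
  reflect (exists2 d, d \notin P & d * x \in I) (x \in sat P I).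
Proof.
move=> Pp; apply: (iffP (asboolP _)) => -[d dP dx]; exists d => //.
  exact: prime_ideal_denom.
exact: denominator_mem.
Qed.

Lemma sub_sat P I : {subset I <= sat P I}.
Proof.
move=> x xI; apply/asboolP; exists 1; rewrite ?mul1r //; exact: denominator1.
Qed.

Lemma sat_sub P I J : {subset I <= sat P J} -> {subset sat P I <= sat P J}.
Proof.
move=> IJ x /asboolP[d dP /IJ/asboolP[e eP edx]]; apply/asboolP.
by exists (e * d); rewrite -?mulrA //; apply: denominatorM.
Qed.

Lemma sat_cancel P I d x : d \notin P -> d * x \in sat P I -> x \in sat P I.
Proof. by move=> dP /(sat_intro dP); apply: sat_sub. Qed.

Lemma sat_prime P I : prime_ideal P -> {subset I <= P} -> {subset sat P I <= P}.
Proof.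
by move=> Pp IP x /(mem_satP _ _ Pp)[d dP /IP/Pp.2]; rewrite (negPf dP).
Qed.

(** Induction on the generators replaces the determinant trick: the relation for [f] is solved for
    [f] locally, then substituted into the others. *)
Lemma nakayama P I s : prime_ideal P ->
  {subset s <= sat P (ideal_sum I (ideal_prod P (ideal_gen s)))} ->
  {subset s <= sat P I}.
Proof.
move=> Pp; elim: s I => [|f s IHs] I sI x //.
set J := ideal_sum I (ideal_prod P (ideal_gen s)).
have fJ : f \in sat P J.
  have /(mem_satP _ _ Pp)[d dP] := sI f (mem_head _ _).
  move=> /asboolP[u [v [uI vP e]]].
  have [c cP v_eq] := ideal_prod_genP vP.
  (* The term [c 0 * f] moves to the left; [d - c 0] stays outside [P] because [c 0] is in [P]. *)
  apply: (@sat_intro _ _ (d - c 0%N)).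
    by apply: contra dP => /(rpredD (cP 0%N)); rewrite addrC subrK.
  rewrite mulrBl e v_eq big_ord_recl /= addrA addrAC addrK.
  apply/asboolP; exists u, (\sum_(i < size s) c i.+1 * s`_i); split=> //.
  apply: rpred_sum => i _; apply: mem_ideal_prod => //.
  by apply: mem_ideal_gen; apply: mem_nth.
have sJ : {subset s <= sat P J}.
  move=> y ys; have := sI y; rewrite inE ys orbT => /(_ isT).
  apply: sat_sub; apply: ideal_sum_sub => z.
    by move=> zI; apply/sub_sat/mem_ideal_suml.
  move=> /ideal_prod_genP[c cP ->]; rewrite big_ord_recl /=.
  rewrite rpredD ?ideal_absorb //; apply: rpred_sum => i _.
  apply/sub_sat/mem_ideal_sumr/mem_ideal_prod => //.
  by apply: mem_ideal_gen; apply: mem_nth; apply: ltn_ord.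
have sIs := IHs _ sJ; rewrite inE => /orP[/eqP->|/sIs//].
apply: sat_sub fJ; apply: ideal_sum_sub => z; first exact: sub_sat.
by apply: ideal_prod_sub => a b aP /(ideal_gen_sub sIs) ?; apply: ideal_absorb.
Qed.

End IdealTheory.

(** * Elements of a prime ideal whose derivatives lie in the prime *)

Section Preimage.
Variables (R S : comPzRingType) (f : {rmorphism R -> S}).
Implicit Types (I J : ideal S).

Definition preim_ideal I : {pred R} := fun x => f x \in I.

Fact preim_ideal_zero I : 0 \in preim_ideal I.
Proof. by rewrite /in_mem /= /preim_ideal rmorph0 rpred0. Qed.
Fact preim_ideal_add I :
  {in preim_ideal I &, forall u v, u + v \in preim_ideal I}.
Proof. by move=> u v uI vI; rewrite /in_mem /= /preim_ideal rmorphD rpredD. Qed.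
Fact preim_ideal_mul I a :
  {in preim_ideal I, forall u, a * u \in preim_ideal I}.
Proof.
by move=> u uI; rewrite /in_mem /= /preim_ideal rmorphM; apply: ideal_absorb.
Qed.
HB.instance Definition _ I := isIdeal.Build R (preim_ideal I)
  (@preim_ideal_zero I) (@preim_ideal_add I) (@preim_ideal_mul I).

Lemma mem_preim_ideal I x : (x \in preim_ideal I) = (f x \in I).
Proof. by []. Qed.

Lemma preim_prime I : prime_ideal I -> prime_ideal (preim_ideal I).
Proof.
move=> [I1 IM]; split=> [|x y]; first by rewrite mem_preim_ideal rmorph1.
by rewrite !mem_preim_ideal rmorphM; apply: IM.
Qed.

Lemma sat_preim_sqr I x : prime_ideal I ->
  x \in sat (preim_ideal I) (ideal_prod (preim_ideal I) (preim_ideal I)) ->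
  f x \in sat I (ideal_prod I I).
Proof.
move=> Ip /(mem_satP _ _ (preim_prime Ip))[d dI dx].
apply: (@sat_intro _ _ _ (f d)) => //; rewrite -rmorphM.
have sub : {subset ideal_prod (preim_ideal I) (preim_ideal I)
             <= preim_ideal (ideal_prod I I)}.
  apply: ideal_prod_sub => a b aI bI; rewrite mem_preim_ideal rmorphM.
  exact: mem_ideal_prod.
exact: (sub _ dx).
Qed.

End Preimage.

Definition leibniz (R : comPzRingType) (d : R -> R) :=
  forall a b, d (a * b) = a * d b + b * d a.

(** For derivations [d i], this says that they jointly embed the cotangent space of the local ring
    at [P] into a power of its residue field. *)
Definition detects_squares (R : comPzRingType) (T : Type) (d : T -> R -> R) :=
  forall (P : ideal R) x, prime_ideal P -> x \in P ->
    (forall i, d i x \in P) -> x \in sat P (ideal_prod P P).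

(* The separability argument: a polynomial [F] in [P] of least degree among
   those with leading coefficient outside [P] has its derivative outside [P],
   and pseudo-division by [F] reduces to polynomials with coefficients in [P]. *)
Section PolynomialExtension.
Variables (R : comNzRingType) (T : Type) (d : T -> {additive R -> R}).
Hypothesis dM : forall i, leibniz (d i).
Hypothesis char0 : forall n, exists y : R, n.+1%:R * y = 1.
Hypothesis dR : detects_squares (fun i => d i : R -> R).

Definition poly_derivations (i : option T) : {poly R} -> {poly R} :=
  if i is Some j then map_poly (d j) else @deriv R.

Lemma map_poly_leibniz i : leibniz (map_poly (d i)).
Proof.
move=> p q; apply/polyP => n; rewrite coefD !coefM coef_map coefM raddf_sum.
rewrite [X in _ = _ + X](reindex_inj rev_ord_inj) -big_split /=.
apply: eq_bigr => j _; rewrite dM !coef_map subSS.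
by rewrite subKn // -ltnS.
Qed.

Lemma poly_derivations_leibniz i : leibniz (poly_derivations i).
Proof.
case: i => [i|]; first exact: map_poly_leibniz.
by move=> p q; rewrite /= derivM addrC [q * _]mulrC.
Qed.

Section Prime.
Variable P : ideal {poly R}.
Hypothesis Pp : prime_ideal P.
Local Notation P0 := (preim_ideal (@polyC R) P).

Lemma natr_notin_prime n : n.+1%:R%:P \notin P.
Proof.
apply/negP => nP; have [y ny] := char0 n; move/negP: Pp.1; apply.
by rewrite -(rmorph1 (@polyC R)) -ny rmorphM mulrC ideal_absorb.
Qed.

(** Subtracting the leading term, which lies in [P], stays in [P] and lowers the size. *)
Lemma coef_in_prime N :
  (forall r, r \in P -> (size r < N)%N -> lead_coef r \in P0) ->
  forall r, r \in P -> (size r < N)%N -> forall i, r`_i \in P0.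
Proof.
move=> leadP r; move: {2}(size r) (leqnn (size r)) => n.
elim: n r => [|n IHn] r.
  by rewrite leqn0 size_poly_eq0 => /eqP-> _ _ i; rewrite coef0 rpred0.
move=> sr rP rN i; have [->|r0] := eqVneq r 0; first by rewrite coef0 rpred0.
have lr := leadP _ rP rN.
pose q := r - (lead_coef r)%:P * 'X^((size r).-1).
have qP : q \in P by rewrite rpredB // mulrC ideal_absorb.
have sq : (size q < size r)%N.
  have sr' : (size r).-1.+1 = size r by rewrite prednK // lt0n size_poly_eq0.
  rewrite -sr' ltnS; apply/leq_sizeP => j.
  rewrite leq_eqVlt => /orP[/eqP<-|jr].
    by rewrite coefB coefCM coefXn eqxx mulr1 lead_coefE subrr.
  rewrite coefB coefCM coefXn gtn_eqF // mulr0 subr0 nth_default //.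
  by rewrite -sr'.
have -> : r`_i = q`_i + (lead_coef r * (i == (size r).-1)%:R).
  by rewrite coefB coefCM coefXn subrK.
rewrite rpredD // 1?mulrC 1?ideal_absorb //.
by apply: IHn => //; [rewrite -ltnS (leq_trans sq) | apply: ltn_trans rN].
Qed.

(** The coefficients of [r] and of its coefficientwise derivatives all lie in [P0], so [dR] applies
    to each coefficient of [r]. *)
Lemma sat_small_poly N :
  (forall r, r \in P -> (size r < N)%N -> lead_coef r \in P0) ->
  forall r, r \in P -> (size r < N)%N ->
  (forall i, poly_derivations i r \in P) -> r \in sat P (ideal_prod P P).
Proof.
move=> leadP r rP rN dP; rewrite -[r]coefK poly_def.
apply: rpred_sum => i _; rewrite -mul_polyC mulrC ideal_absorb //.
apply: sat_preim_sqr => //; apply: dR => [||j]; first exact: preim_prime.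
  exact: coef_in_prime rP rN _.
have := coef_in_prime leadP (dP (Some j)) _ i; rewrite coef_map; apply.
exact: leq_ltn_trans (size_poly _ _) rN.
Qed.

Lemma sat_poly r : r \in P ->
  (forall i, poly_derivations i r \in P) -> r \in sat P (ideal_prod P P).
Proof.
move=> rP dP.
pose B n := `[< exists2 F, F \in P /\ lead_coef F \notin P0 & size F = n >].
(* If there is no such [F], all polynomials in [P] have leading coefficient in [P0], and [r] counts
   as small. *)
have [exB|noB] := pselect (exists n, B n); last first.
  apply: (@sat_small_poly (size r).+1) => // q qP _; apply/negPn/negP => lq.
  by apply: noB; exists (size q); apply/asboolP; exists q.
case: (ex_minnP exB) => _ /asboolP[F [FP lF] <-] minF.
have leadP q : q \in P -> (size q < size F)%N -> lead_coef q \in P0.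
  move=> qP; rewrite ltnNge => /negP qF; apply/negPn/negP => lq; apply: qF.
  by apply: minF; apply/asboolP; exists q.
have F0 : F != 0 by apply: contra lF => /eqP->; rewrite lead_coef0 rpred0.
set l := lead_coef F in lF.
have sF : (1 < size F)%N.
  rewrite ltnNge; apply: contra lF => /size1_polyC e.
  by rewrite mem_preim_ideal /l e lead_coefC /= -e.
(* The leading coefficient of [F'] is [l] times the positive integer [(size F).-1], which is
   invertible; as [F'] is shorter than [F], having [F'] in [P] would put [l] in [P0]. *)
have F'P : F^`() \notin P.
  apply: contra lF => F'P; have := coef_in_prime leadP F'P.
  rewrite lt_size_deriv // => /(_ isT (size F).-2); rewrite coef_deriv.
  rewrite -subn2 -subSn // subn2 /= -lead_coefE -/l mem_preim_ideal.
  case: (size F) sF => [|[|n]] // _ /=; rewrite -mulr_natr rmorphM /=.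
  by case/(Pp.2)/orP => //; rewrite (negPf (natr_notin_prime _)).
(* Pseudo-division gives [l ^+ n *: r = q * F + s] with [s] shorter than [F]; the factor [l ^+ n] is
   outside [P], hence harmless locally. *)
have := Pdiv.ComRing.rdivp_eq F r.
have := Pdiv.Ring.ltn_rmodp r F.
move: (Pdiv.Ring.rdivp r F) (Pdiv.Ring.rmodp r F) (Pdiv.Ring.rscalp r F).
rewrite F0 => q s n sF' e.
have ln : (l ^+ n)%:P \notin P.
  elim: n {e} => [|n IHn]; first by rewrite expr0 Pp.1.
  by rewrite exprS rmorphM; apply/negP => /(Pp.2)/orP[|]; apply/negP.
apply: (sat_cancel ln); rewrite mul_polyC e.
have sP : s \in P.
  have -> : s = (l ^+ n)%:P * r - q * F by rewrite mul_polyC e addrC addKr.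
  by rewrite rpredB // ideal_absorb.
have dD i : {morph poly_derivations i : a b / a + b}.
  by case: i => [i|] a b; rewrite /= ?raddfD ?derivD.
have de i : q * poly_derivations i F + poly_derivations i s \in P.
  have : poly_derivations i (q * F + s) \in P.
    rewrite -e -mul_polyC poly_derivations_leibniz rpredD //.
      by rewrite ideal_absorb.
    by rewrite mulrC ideal_absorb.
  rewrite dD poly_derivations_leibniz => dP'.
  rewrite -[X in X \in P](addrK (F * poly_derivations i q)) rpredB //.
    by rewrite addrAC.
  by rewrite mulrC ideal_absorb.
(* Take [de] at [None]: the coefficients of [s'] are integer multiples of those of [s], so [q * F']
   is in [P] while [F'] is not. Then [q * F] lies in the square of [P], and only [s] remains. *)
have qP : q \in P.
  have : q * F^`() \in P.
    rewrite -[X in X \in P](addrK s^`()) rpredB ?(de None) //.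
    rewrite -[X in X \in P]coefK poly_def rpred_sum // => i _.
    rewrite coef_deriv -mul_polyC mulrC ideal_absorb // raddfMn rpredMn //.
    exact: (coef_in_prime leadP sP sF' i.+1).
  by case/(Pp.2)/orP => //; rewrite (negPf F'P).
rewrite rpredD //; first exact/sub_sat/mem_ideal_prod.
apply: sat_small_poly leadP _ sP sF' _ => i.
rewrite -[X in X \in P](addKr (q * poly_derivations i F)) rpredD // rpredN.
by rewrite mulrC ideal_absorb.
Qed.

End Prime.

Lemma poly_detects_squares : detects_squares poly_derivations.
Proof. by move=> P x Pp xP dP; apply: sat_poly. Qed.

End PolynomialExtension.

(** * Adjoining the last variable to a multivariate polynomial ring *)

Section LastVariable.
Variables (k : fieldType) (n : nat).
Local Notation widen := (widen_ord (leqnSn n)).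

Definition poly_to_mpoly : {poly {mpoly k[n]}} -> {mpoly k[n.+1]} :=
  horner_eval 'X_ord_max \o map_poly (@mwiden n k).

HB.instance Definition _ := GRing.RMorphism.copy poly_to_mpoly
  (horner_eval (@mpolyX n.+1 k U_(ord_max)) \o map_poly (@mwiden n k)).

Lemma poly_to_mpolyCX c i :
  poly_to_mpoly (c%:P * 'X^i) = mwiden c * 'X_ord_max ^+ i.
Proof.
rewrite /poly_to_mpoly /= /horner_eval rmorphM /= map_polyC map_polyXn.
by rewrite hornerM hornerC hornerXn.
Qed.

Lemma ord_max_or_widen (j : 'I_n.+1) : j = ord_max \/ exists i, j = widen i.
Proof.
have [i ->|] := unliftP ord_max j; last by left.
by right; exists i; apply: val_inj; apply: lift_max.
Qed.

Lemma poly_to_mpoly_surj p : exists q, poly_to_mpoly q = p.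
Proof.
elim/mpolyind: p => [|c m p _ _ [q <-]]; first by exists 0; rewrite rmorph0.
suff [r r_eq] : exists r, poly_to_mpoly r = 'X_[m].
  exists ((c%:MP)%:P * r + q); rewrite rmorphD rmorphM /= r_eq.
  rewrite -[(c%:MP)%:P]mulr1 -(expr0 'X) poly_to_mpolyCX expr0 mulr1 mwidenC.
  by rewrite mul_mpolyC.
rewrite mpolyXE_id; elim/big_ind: _ => [|_ _ [r <-] [s <-]|j _].
- by exists 1; rewrite rmorph1.
- by exists (r * s); rewrite rmorphM.
have [->|[i ->]] := ord_max_or_widen j.
  exists ('X^(m ord_max)).
  by rewrite -['X^_]mul1r poly_to_mpolyCX mwiden1 mul1r.
exists (('X_i ^+ m (widen i))%:P); rewrite -[_%:P]mulr1 -(expr0 'X).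
by rewrite poly_to_mpolyCX rmorphXn /= mwidenX mnmwiden1 expr0 mulr1.
Qed.

Lemma mderiv_mwiden i (p : {mpoly k[n]}) :
  (mwiden p)^`M(widen i) = mwiden p^`M(i).
Proof.
elim/mpolyind: p => [|c m p _ _ IHp]; first by rewrite !raddf0.
rewrite !raddfD /= IHp !(mwidenZ, mderivZ); congr (_ *: _ + _).
rewrite mwidenX !mderivX mwidenZ mwidenX mnmwiden_widen; congr (_ *: 'X_[_]).
apply/mnmP => j; rewrite mnmBE -mnmwiden1.
have [->|[l ->]] := ord_max_or_widen j; first by rewrite !mnmwiden_ordmax.
by rewrite !mnmwiden_widen mnmBE.
Qed.

Lemma mderiv_max_mwiden (p : {mpoly k[n]}) : (mwiden p)^`M(ord_max) = 0.
Proof.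
elim/mpolyind: p => [|c m p _ _ IHp]; first by rewrite !raddf0.
rewrite !raddfD /= IHp !(mwidenZ, mderivZ) mwidenX mderivX mnmwiden_ordmax.
by rewrite scale0r scaler0 addr0.
Qed.

Lemma mderiv_max_Xn i :
  ('X_ord_max ^+ i : {mpoly k[n.+1]})^`M(ord_max) = 'X_ord_max ^+ i.-1 *+ i.
Proof.
elim: i => [|i IHi]; first by rewrite expr0 mulr0n mderivC.
rewrite exprS mderivM IHi mderivX mnm1E eqxx scale1r.
rewrite (_ : (_ - _)%MM = 0%MM) ?mpolyX0; last first.
  by apply/mnmP => j; rewrite mnmBE subnn mnm0E.
case: i {IHi} => [|i]; first by rewrite mulr0n mulr0 addr0 mul1r.
by rewrite mul1r mulrnAr -exprS -mulrS.
Qed.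

Lemma mderiv_widen_Xn j i :
  ('X_ord_max ^+ i : {mpoly k[n.+1]})^`M(widen j) = 0.
Proof.
elim: i => [|i IHi]; first by rewrite expr0 mderivC.
rewrite exprS mderivM IHi mderivX mnm1E mulr0 addr0.
by rewrite -val_eqE /= gtn_eqF // scale0r mul0r.
Qed.

Lemma polyCX_ind (p : {poly {mpoly k[n]}} -> Prop) :
  (forall q r, p q -> p r -> p (q + r)) ->
  (forall c i, p (c%:P * 'X^i)) -> forall q, p q.
Proof.
move=> pD pCX q; rewrite -[q]coefK poly_def.
elim/big_ind: _ => [||i _]; [|exact: pD|by rewrite -mul_polyC].
by have := pCX 0 0%N; rewrite mul0r.
Qed.

Lemma mderiv_widen_poly_to_mpoly j q :
  (poly_to_mpoly q)^`M(widen j) = poly_to_mpoly (map_poly (@mderiv n k j) q).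
Proof.
elim/polyCX_ind: q => [q r IHq IHr|c i]; first by rewrite !raddfD /= IHq IHr.
rewrite poly_to_mpolyCX mderivM mderiv_widen_Xn mulr0 addr0.
have -> : map_poly (@mderiv n k j) (c%:P * 'X^i) = (c^`M(j))%:P * 'X^i.
  apply/polyP => l; rewrite coef_map [in RHS]coefCM coefCM !coefXn /=.
  by case: (l == i); rewrite ?mulr1 // !mulr0 mderiv0.
by rewrite poly_to_mpolyCX -mderiv_mwiden.
Qed.

Lemma mderiv_max_poly_to_mpoly q :
  (poly_to_mpoly q)^`M(ord_max) = poly_to_mpoly q^`().
Proof.
elim/polyCX_ind: q => [q r IHq IHr|c i].
  by rewrite derivD !raddfD /= IHq IHr.
rewrite (poly_to_mpolyCX c i) mderivM mderiv_max_mwiden mul0r add0r.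
rewrite mderiv_max_Xn.
have -> : (c%:P * 'X^i)^`() = c%:P * 'X^(i.-1) *+ i.
  by rewrite deriv_mulC derivXn mulrnAr.
by rewrite raddfMn /= (poly_to_mpolyCX c i.-1) mulrnAr.
Qed.

End LastVariable.

Lemma mderiv_leibniz (k : fieldType) n (i : 'I_n) : leibniz (@mderiv n k i).
Proof. by move=> p q; rewrite mderivM addrC [q * _]mulrC. Qed.

Lemma mpoly_char0 (k : fieldType) n : [pchar k] =i pred0 ->
  forall i, exists y : {mpoly k[n]}, i.+1%:R * y = 1.
Proof.
move=> char0 i; exists ((i.+1%:R : k)^-1)%:MP.
rewrite -mpolyC_nat -mpolyCM mulfV ?mpolyC1 //.
by rewrite ((pcharf0P k).1 char0).
Qed.

(** Induction on the number of variables. Without variables, nonzero elements are units; in the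
    step, [P] is pulled back to univariate polynomials in the last variable. *)
Lemma mpoly_detects_squares (k : fieldType) n : [pchar k] =i pred0 ->
  detects_squares (@mderiv n k).
Proof.
move=> char0; elim: n => [|n IHn].
  move=> P x Pp xP _; have [x0|x0] := eqVneq x 0; first by rewrite x0 rpred0.
  case/negP: Pp.1; rewrite (nvar0_mpolyC x) in x0 xP.
  rewrite mpolyC_eq0 in x0.
  by rewrite -(mpolyC1 0 k) -(mulVf x0) mpolyCM ideal_absorb.
move=> P x Pp; have [q <-] := poly_to_mpoly_surj x => qP dP.
pose d i : {additive {mpoly k[n]} -> {mpoly k[n]}} := @mderiv n k i.
have dS := @poly_detects_squares {mpoly k[n]} 'I_n d (@mderiv_leibniz k n)
  (mpoly_char0 n char0) IHn.
pose f : {rmorphism {poly {mpoly k[n]}} -> {mpoly k[n.+1]}} :=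
  @poly_to_mpoly k n.
have dq i : poly_derivations d i q \in preim_ideal f P.
  rewrite mem_preim_ideal; case: i => [j|].
    rewrite /= -mderiv_widen_poly_to_mpoly; exact: dP.
  rewrite /= -mderiv_max_poly_to_mpoly; exact: dP.
exact: (sat_preim_sqr Pp (dS _ q (preim_prime f Pp) qP dq)).
Qed.

(** * Regular sequences modulo an ideal *)

Section RegularSystem.
Variable R : comPzRingType.
Implicit Types (I J h P : ideal R) (gs fs : seq R).

Lemma ideal_gen_takeP gs i x : (i <= size gs)%N ->
  reflect (exists c : nat -> R, x = \sum_(j < i) c j * gs`_j)
          (x \in ideal_gen (take i gs)).
Proof.
move=> igs; have sz : size (take i gs) = i by rewrite size_takel.
apply: (iffP (ideal_genP _ _)) => -[c ->]; exists c.
  by rewrite sz; apply: eq_bigr => j _; rewrite nth_take.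
by rewrite sz; apply: eq_bigr => j _; rewrite nth_take.
Qed.

(* [gs] is a regular sequence on the localization of [R/h] at [P]. *)
Definition regular_at P h gs :=
  forall i, (i < size gs)%N -> forall x,
    x * gs`_i \in sat P (ideal_sum h (ideal_gen (take i gs))) ->
    x \in sat P (ideal_sum h (ideal_gen (take i gs))).

Variables (P h : ideal R) (gs : seq R).
Hypotheses (Pp : prime_ideal P) (hP : {subset h <= P}) (gsP : {subset gs <= P}).
Hypothesis gs_reg : regular_at P h gs.

Lemma ideal_gen_take_sub i : {subset ideal_gen (take i gs) <= P}.
Proof. by apply: ideal_gen_sub => x /mem_take/gsP. Qed.

(** Regularity puts the last coefficient locally in [h + (g_0, ..., g_(i-1))], hence in [P].
    Substituting its expression gives a shorter relation with coefficients [d * b j + e j * g_i],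
    congruent to [d * b j] modulo [P]. *)
Lemma regular_at_coef i (b : nat -> R) : (i <= size gs)%N ->
  \sum_(j < i) b j * gs`_j \in sat P h ->
  forall j, (j < i)%N -> b j \in P.
Proof.
elim: i b => [|i IHi] b // ilt; rewrite big_ord_recr /= => sum_h.
have igs := ltnW ilt; have hS : {subset h <= sat P h} by exact: sub_sat.
have bi : b i \in sat P (ideal_sum h (ideal_gen (take i gs))).
  apply: gs_reg => //; case/(mem_satP _ _ Pp): sum_h => d dP dh.
  apply: (sat_intro dP); apply/asboolP.
  exists (d * (\sum_(j < i) b j * gs`_j + b i * gs`_i)).
  exists (- \sum_(j < i) (d * b j) * gs`_j); split=> //.
    by rewrite rpredN; apply/(ideal_gen_takeP _ igs); exists (fun j => d * b j).
  rewrite mulrDr mulr_sumr addrAC -sumrB big1 ?add0r // => j _.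
  by rewrite mulrA subrr.
have biP : b i \in P.
  apply: sat_prime bi => //; apply: ideal_sum_sub => //.
  exact: ideal_gen_take_sub.
have [d dP] := mem_satP _ _ Pp bi.
move=> /asboolP[u [v [uh /(ideal_gen_takeP _ igs)[e ->] dbi]]].
have sum_h' : \sum_(j < i) (d * b j + e j * gs`_i) * gs`_j \in sat P h.
  have -> : \sum_(j < i) (d * b j + e j * gs`_i) * gs`_j =
      d * (\sum_(j < i) b j * gs`_j + b i * gs`_i) - gs`_i * u.
    rewrite mulrDr [d * (b i * _)]mulrA dbi mulrDl mulr_sumr mulr_suml.
    under eq_bigr => j _ do rewrite mulrDl; rewrite big_split /= -addrA.
    rewrite [gs`_i * u]mulrC [u * _ + _]addrC addrK; congr (_ + _).
      by apply: eq_bigr => j _; rewrite mulrA.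
    by apply: eq_bigr => j _; rewrite mulrAC.
  rewrite rpredB ?ideal_absorb //; exact: hS.
move=> j; rewrite ltnS leq_eqVlt => /orP[/eqP->//|ji].
have := IHi (fun j => d * b j + e j * gs`_i) igs sum_h' j ji.
have gP : e j * gs`_i \in P by rewrite ideal_absorb // gsP // mem_nth.
move=> /rpredB/(_ gP); rewrite addrK => /(Pp.2)/orP[] //.
by rewrite (negPf dP).
Qed.

Hypothesis P_gen : {subset P <= sat P (ideal_sum h (ideal_gen gs))}.

Lemma sqr_sub_sat :
  {subset ideal_prod P P <= sat P (ideal_sum h (ideal_prod P (ideal_gen gs)))}.
Proof.
apply: ideal_prod_sub => x y xP /P_gen/(mem_satP _ _ Pp)[d dP].
move=> /asboolP[u [v [uh vgs e]]]; apply: (sat_intro dP).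
rewrite mulrCA e mulrDr rpredD //.
  by apply: mem_ideal_suml; apply: ideal_absorb.
by apply: mem_ideal_sumr; apply: mem_ideal_prod.
Qed.

(** Locally, modulo [h], the square of [P] is contained in [P] times [(gs)]. This gives a relation
    modulo [h] with coefficients [d * c j - p j], where [p j] is in [P]. *)
Lemma conormal_coef (c : nat -> R) :
  \sum_(j < size gs) c j * gs`_j \in sat P (ideal_sum h (ideal_prod P P)) ->
  forall j, (j < size gs)%N -> c j \in P.
Proof.
have sub : {subset ideal_sum h (ideal_prod P P) <=
    sat P (ideal_sum h (ideal_prod P (ideal_gen gs)))}.
  apply: ideal_sum_sub => [x xh|]; last exact: sqr_sub_sat.
  by apply/sub_sat/mem_ideal_suml.
move=> /(sat_sub sub)/(mem_satP _ _ Pp)[d dP].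
move=> /asboolP[u [_ [uh /ideal_prod_genP[p pP ->] e]]] j jgs.
have : \sum_(j < size gs) (d * c j - p j) * gs`_j \in sat P h.
  suff -> : \sum_(j < size gs) (d * c j - p j) * gs`_j = u by exact: sub_sat.
  under eq_bigr => i _ do rewrite mulrBl -mulrA.
  by rewrite sumrB -mulr_sumr e addrK.
move=> /(@regular_at_coef _ (fun j => d * c j - p j) (leqnn _))/(_ _ jgs).
move=> /rpredD/(_ (pP j)); rewrite subrK => /(Pp.2)/orP[] //.
by rewrite (negPf dP).
Qed.

(* Descending induction on [i] for [h <= J + (g_0, ..., g_(i-1))] locally at
   [P]: cancelling [g_i] modulo [h + (g_0, ..., g_(i-1))] makes Nakayama's
   lemma applicable. *)
Lemma regular_descent fs J : generating_set fs h -> {subset J <= h} ->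
  {subset h <= sat P (ideal_sum J (ideal_prod P P))} -> {subset h <= sat P J}.
Proof.
move=> fsh Jh hJ.
have gen_h (x : R) : (x \in ideal_gen fs) = (x \in h) by exact: fsh.
have fs_h : {subset fs <= h} by move=> x /mem_ideal_gen; rewrite gen_h.
have nak I : {subset h <= sat P (ideal_sum I (ideal_prod P h))} ->
    {subset h <= sat P I}.
  move=> hI x; rewrite -gen_h; move: x; apply: ideal_gen_sub.
  apply: nakayama => // x /fs_h/hI; apply: sat_sub; apply: ideal_sum_sub => y.
    by move=> yI; apply/sub_sat/mem_ideal_suml.
  move: y; apply: ideal_prod_sub => a b aP bh.
  by apply/sub_sat/mem_ideal_sumr/mem_ideal_prod; rewrite ?gen_h.
have hJgs : {subset h <= sat P (ideal_sum J (ideal_gen gs))}.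
  apply: nak => x /hJ; apply: sat_sub; apply: ideal_sum_sub => y.
    by move=> yJ; apply/sub_sat/mem_ideal_suml/mem_ideal_suml.
  move: y; apply: ideal_prod_sub => a b aP /P_gen/(mem_satP _ _ Pp)[d dP].
  move=> /asboolP[u [v [uh vgs e]]]; apply: (sat_intro dP).
  rewrite mulrCA e mulrDr rpredD //.
    by apply: mem_ideal_sumr; apply: mem_ideal_prod.
  by apply/mem_ideal_suml/mem_ideal_sumr/ideal_absorb.
suff desc i : (i <= size gs)%N ->
    {subset h <= sat P (ideal_sum J (ideal_gen (take (size gs - i) gs)))}.
  move=> x /(desc _ (leqnn _)); rewrite subnn take0; apply: sat_sub.
  apply: ideal_sum_sub => y; first exact: sub_sat.
  by move=> /ideal_genP[c ->]; rewrite big_ord0 rpred0.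
elim: i => [|i IHi] ilt; first by rewrite subn0 take_size.
have {IHi} := IHi (ltnW ilt).
have jgs : (size gs - i.+1 < size gs)%N by rewrite ltn_subrL (leq_trans _ ilt).
have -> : (size gs - i = (size gs - i.+1).+1)%N by rewrite -subSn.
move: (size gs - i.+1)%N jgs => j jgs hJj; apply: nak => x xh.
have [d dP /asboolP[u [_ [uJ /(ideal_gen_takeP _ jgs)[c ->] e]]]] :=
  mem_satP _ _ Pp (hJj x xh).
rewrite big_ord_recr /= in e; set v := \sum_(_ < _) _ in e.
have vgs : v \in ideal_gen (take j gs).
  by apply/(ideal_gen_takeP _ (ltnW jgs)); exists c.
(* Since [d * x - u] is in [h], the term [c j * g_j] lies in [h + (g_0, ..., g_(j-1))], where [g_j]
   can be cancelled. *)
have : c j * gs`_j \in sat P (ideal_sum h (ideal_gen (take j gs))).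
  apply/sub_sat/asboolP; exists (d * x - u), (- v); split; rewrite ?rpredN //.
    by rewrite rpredB ?ideal_absorb // Jh.
  by rewrite e; ring.
move=> /(gs_reg jgs)/(mem_satP _ _ Pp)[s sP /asboolP[u' [v' [u'h v'gs e']]]].
have sdP : s * d \notin P.
  by apply/negP => /(Pp.2)/orP[]; apply/negP.
apply: (sat_intro sdP).
have -> : s * d * x = s * u + (s * v + gs`_j * v') + gs`_j * u'.
  rewrite -mulrA e !mulrDr mulrA e' mulrDl [u' * _]mulrC [v' * _]mulrC.
  by rewrite !addrA; ring.
rewrite rpredD //.
  apply: mem_ideal_suml; rewrite rpredD //.
    by apply/mem_ideal_suml/ideal_absorb.
  by apply: mem_ideal_sumr; rewrite rpredD // ideal_absorb.
apply: mem_ideal_sumr; apply: mem_ideal_prod => //.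
by apply: gsP; apply: mem_nth.
Qed.

End RegularSystem.

(** * Derivations preserving an ideal *)

(** The product of denominators for the finitely many generators works for the whole ideal. *)
Lemma sat_common_denom (R : comPzRingType) (P J : ideal R) fs :
  prime_ideal P -> {subset ideal_gen fs <= sat P J} ->
  exists2 s, s \notin P & forall x, x \in ideal_gen fs -> s * x \in J.
Proof.
move=> Pp fsJ.
have {fsJ} : {subset fs <= sat P J} by move=> x /mem_ideal_gen/fsJ.
elim: fs => [|f fs IHfs] fsJ.
  exists 1; first exact: Pp.1.
  by move=> x /ideal_genP[c ->]; rewrite big_ord0 mulr0 rpred0.
have [|s sP sJ] := IHfs.
  by move=> x xfs; apply: fsJ; rewrite inE xfs orbT.
have [d dP dJ] := mem_satP _ _ Pp (fsJ f (mem_head _ _)).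
exists (d * s); first by apply/negP => /(Pp.2)/orP[]; apply/negP.
move=> x /ideal_genP[c ->]; rewrite big_ord_recl /= mulrDr rpredD //.
  have -> : d * s * (c 0%N * f) = s * c 0%N * (d * f) by ring.
  exact: ideal_absorb.
rewrite -mulrA ideal_absorb //; apply: sJ; apply: rpred_sum => i _.
by apply: ideal_absorb; apply: mem_ideal_gen; apply: mem_nth; apply: ltn_ord.
Qed.

Section Elimination.
Variables (k : fieldType) (m : nat).
Local Notation O := {mpoly k[m]}.
Implicit Types (P h J : ideal O) (th : 'I_m -> {linear O -> O}).

(** The invariant of the elimination, a form of [detects_squares] at [P] modulo [J]. In
    characteristic zero it holds initially for the partial derivatives and the zero ideal. *)
Definition eliminating P h th J :=
  [/\ {subset J <= h}, forall j, derivation (th j),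
      forall j x, x \in J -> th j x \in J &
      forall x, x \in P -> (forall j, th j x \in P) ->
        x \in sat P (ideal_sum J (ideal_prod P P))].

(* Gaussian elimination on the Jacobian matrix of [h] modulo [P]: a pivot
   [th j0 F], with [F] in [h], is used to clear the column of [F], so that
   [F] can be added to [J]; this makes [th j0] vanish. *)
Lemma elimination_exists P h th J : prime_ideal P -> {subset h <= P} ->
  eliminating P h th J ->
  exists th' J', eliminating P h th' J' /\
    forall j x, x \in h -> th' j x \in P.
Proof.
move=> Pp hP.
(* The induction is on a bound for the number of derivations not yet made zero; [A] contains their
   indices. *)
suff H n (A : {set 'I_m}) th1 J1 : (#|A| <= n)%N ->
    (forall j, j \notin A -> forall x, th1 j x = 0) -> eliminating P h th1 J1 ->
    exists th' J', eliminating P h th' J' /\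
      forall j x, x \in h -> th' j x \in P.
  by apply: (H #|[set: 'I_m]| [set: 'I_m]) => // j; rewrite inE.
elim: n A th1 J1 => [|n IHn] A th1 J1 An th0 E.
  exists th1, J1; split=> // j x _; rewrite th0 ?rpred0 //.
  by move: An; rewrite leqn0 cards_eq0 => /eqP->; rewrite inE.
have [noF|] := pselect (forall j x, x \in h -> th1 j x \in P).
  by exists th1, J1.
move=> /existsNP[j0 /existsNP[F /not_implyP[Fh /negP pivot]]].
case: E => Jh thD thJ thE.
(* Every [th2 j] kills [F], and [th2 j0] is zero, so [j0] leaves [A]. *)
have [th2 th2E] : exists th2 : 'I_m -> {linear O -> O}, forall j x,
    th2 j x = th1 j0 F * th1 j x - th1 j F * th1 j0 x.
  by exists (fun j => (th1 j0 F \*o th1 j) \- (th1 j F \*o th1 j0)).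
have j0A : j0 \in A.
  by apply: contraR pivot => /th0->; rewrite rpred0.
apply: (IHn (A :\ j0) th2 (ideal_sum J1 (ideal_gen [:: F]))).
- by move: An; rewrite (cardsD1 j0) j0A.
- move=> j; rewrite !inE negb_and negbK => /orP[/eqP->|jA] x.
    by rewrite th2E subrr.
  by rewrite th2E !(th0 j jA) mulr0 mul0r subrr.
have FP := hP _ Fh.
have th2D j : derivation (th2 j).
  by move=> a b; rewrite !th2E !thD; ring.
split=> // [|j x|x xP thx].
- apply: ideal_sum_sub => //; apply: ideal_gen_sub => x.
  by rewrite inE => /eqP->.
- case/asboolP => u [_ [uJ /ideal_genP[c ->] ->]]; rewrite big_ord1 /=.
  rewrite linearD rpredD //.
    by apply: mem_ideal_suml; rewrite th2E rpredB // ideal_absorb // thJ.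
  apply: mem_ideal_sumr; rewrite th2D th2E [th1 j F * _]mulrC subrr mulr0 add0r.
  by rewrite mulrC ideal_absorb // mem_ideal_gen // mem_head.
(* Modulo [P], [th1 j y] equals [th2 j x] because [x] and [F] are in [P]. So the old invariant
   applies to [y], which is [x] times the pivot up to a multiple of [F]. *)
set y := th1 j0 F * x - th1 j0 x * F.
have yP : y \in P by rewrite rpredB ?ideal_absorb.
have yE : y \in sat P (ideal_sum J1 (ideal_prod P P)).
  apply: thE => // j; rewrite raddfB /= !thD.
  have -> : th1 j0 F * th1 j x + x * th1 j (th1 j0 F) -
      (th1 j0 x * th1 j F + F * th1 j (th1 j0 x)) =
      th2 j x + (th1 j (th1 j0 F) * x - th1 j (th1 j0 x) * F).
    by rewrite th2E; ring.
  by rewrite rpredD // rpredB // ideal_absorb.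
apply: (sat_cancel pivot).
have -> : th1 j0 F * x = y + th1 j0 x * F by rewrite /y subrK.
rewrite rpredD //.
  apply: sat_sub yE; apply: ideal_sum_sub => z zI; apply: sub_sat.
    by apply/mem_ideal_suml/mem_ideal_suml.
  exact: mem_ideal_sumr.
rewrite ideal_absorb //; apply/sub_sat/mem_ideal_suml/mem_ideal_sumr.
by apply: mem_ideal_gen; apply: mem_head.
Qed.

(** The contribution of a single prime; for a radical ideal, membership is then decided by its
    associated primes. *)
Lemma derivation_detects_coef P h fs gs (a : nat -> O) :
  [pchar k] =i pred0 -> prime_ideal P -> {subset h <= P} -> {subset gs <= P} ->
  generating_set fs h -> regular_at P h gs ->
  {subset P <= sat P (ideal_sum h (ideal_gen gs))} ->
  (forall xi, derivation_along h xi ->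
     xi (\sum_(j < size gs) a j * gs`_j) \in P) ->
  forall j, (j < size gs)%N -> a j \in P.
Proof.
move=> char0 Pp hP gsP fsh gs_reg P_gen aP.
have gen_h (x : O) : (x \in ideal_gen fs) = (x \in h) by exact: fsh.
have E0 : eliminating P h (@mderiv m k) (ideal_gen [::]).
  split=> [x|j|j x|x xP dP].
  - by move=> /ideal_genP[c ->]; rewrite big_ord0 rpred0.
  - exact: mderiv_leibniz.
  - by move=> /ideal_genP[c ->]; rewrite big_ord0 linear0 rpred0.
  apply: sat_sub (mpoly_detects_squares char0 Pp xP dP) => y yP.
  exact/sub_sat/mem_ideal_sumr.
have [th [J [[Jh thD thJ thE] thP]]] := elimination_exists Pp hP E0.
have hJ : {subset h <= sat P J}.
  apply: (regular_descent Pp gsP gs_reg P_gen fsh Jh) => x xh.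
  by apply: thE => [|j]; [apply: hP | apply: thP].
have [s sP sJ] : exists2 s, s \notin P & forall x, x \in h -> s * x \in J.
  have [|s sP sJ] := @sat_common_denom _ P J fs Pp.
    by move=> x; rewrite gen_h; apply: hJ.
  by exists s => // x xh; apply: sJ; rewrite gen_h.
set f := \sum_(j < size gs) a j * gs`_j in aP *.
have fP : f \in P.
  by apply: rpred_sum => i _; apply: ideal_absorb; apply: gsP; apply: mem_nth.
have thf j : th j f \in P.
  (* For [b] in [h], [s * b] is in [J], which [th j] preserves; [xi b] differs from [th j (s * b)]
     by a multiple of [b], so [xi] preserves [h]. *)
  pose xi : {linear O -> O} := s \*o th j.
  have xiD : derivation_along h xi.
    split=> [b c|b bh]; first by rewrite /xi /= thD; ring.
    have -> : xi b = th j (s * b) - th j s * b by rewrite thD /xi /=; ring.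
    by rewrite rpredB ?ideal_absorb // Jh // thJ // sJ.
  by have /(Pp.2)/orP[|//] : s * th j f \in P := aP _ xiD; rewrite (negPf sP).
apply: (conormal_coef Pp hP gsP gs_reg P_gen).
apply: sat_sub (thE f fP thf); apply: ideal_sum_sub => x xI; apply: sub_sat.
  by apply/mem_ideal_suml/Jh.
exact: mem_ideal_sumr.
Qed.

End Elimination.

(** * Associated primes of radical ideals *)

(** Choose repeatedly an index, beyond the previous one, whose value is minimal on the remaining
    tail. *)
Lemma nondecreasing_subseq (u : nat -> nat) : exists phi : nat -> nat,
  {homo phi : i j / (i < j)%N} /\ {homo u \o phi : i j / (i <= j)%N}.
Proof.
have ex_min N : exists i, (N <= i)%N /\ forall j, (i <= j)%N -> (u i <= u j)%N.
  pose B v := `[< exists2 i, (N <= i)%N & u i = v >].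
  have exB : exists v, B v by exists (u N); apply/asboolP; exists N.
  case: (ex_minnP exB) => _ /asboolP[i Ni <-] mini.
  exists i; split=> // j ij; apply: mini; apply/asboolP; exists j => //.
  exact: leq_trans ij.
have [c cP] := choice ex_min.
pose phi := fix phi n := if n is n'.+1 then c (phi n').+1 else c 0%N.
have phi_inc : {homo phi : i j / (i < j)%N}.
  by apply: homo_ltn => [|i]; [apply: ltn_trans | have [] := cP (phi i).+1].
have phi_min i j : (phi i <= j)%N -> (u (phi i) <= u j)%N.
  by case: i => [|i]; apply: (cP _).2.
exists phi; split=> // i j; rewrite leq_eqVlt => /orP[/eqP->//|/phi_inc/ltnW].
exact: phi_min.
Qed.

(** Extract subsequences one coordinate at a time; the first two terms of the last one are
    comparable. *)
Lemma dickson n (f : nat -> 'X_{1..n}) :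
  exists i j, (i < j)%N /\ (f i <= f j)%MM.
Proof.
suff [phi [phi_inc phi_mono]] : exists phi : nat -> nat,
    {homo phi : i j / (i < j)%N} /\ forall l, l \in enum 'I_n ->
    {homo (fun i => f (phi i) l) : i j / (i <= j)%N}.
  exists (phi 0%N), (phi 1%N); split; first exact: phi_inc.
  by apply/mnm_lepP => l; apply: (phi_mono l _ 0%N 1%N); rewrite ?mem_enum.
elim: (enum 'I_n) => [|l s [phi [phi_inc phi_mono]]]; first by exists id; split.
have [psi [psi_inc psi_mono]] := nondecreasing_subseq (fun i => f (phi i) l).
exists (phi \o psi); split=> [i j ij|l']; first exact/phi_inc/psi_inc.
rewrite inE => /orP[/eqP->|l's] i j ij; first exact: psi_mono.
apply: (phi_mono _ l's (psi i) (psi j)); move: ij.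
rewrite leq_eqVlt => /orP[/eqP->//|].
by move/psi_inc/ltnW.
Qed.

(** * Chain condition for ideals of polynomials *)

Section Noetherian.
Variables (k : fieldType) (n : nat).
Local Notation O := {mpoly k[n]}.

Lemma mlead_minimal (A : O -> Prop) : (exists p, A p) ->
  exists2 p, A p & forall q, A q -> ~ (mlead q < mlead p)%O.
Proof.
move=> [p Ap]; apply: contrapT => noMin.
have nA : forall m q, mlead q = m -> ~ A q.
  apply: (@ltmwf n) => m IHm q qm Aq; apply: noMin; exists q => // r Ar rq.
  by apply: (IHm (mlead r) _ r) => //; rewrite -qm.
exact: nA Ap.
Qed.

(** One division step. The zero remainder is a separate case because [mlead 0] is the monomial 1,
    which is not below a constant leading monomial. *)
Lemma mlead_cancel (p q : O) : p != 0 -> (mlead p <= mlead q)%MM ->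
  exists c : O, q - c * p = 0 \/ (mlead (q - c * p) < mlead q)%O.
Proof.
move=> p0 pq; pose a := q@_(mlead q) / p@_(mlead p).
exists (a *: 'X_[mlead q - mlead p]); set r := _ * p.
have [|rq0] := eqVneq (q - r) 0; [by left | right].
have p0' : p@_(mlead p) != 0 by rewrite mleadc_eq0.
have rE : r@_(mlead q) = q@_(mlead q).
  rewrite /r -scalerAl mcoeffZ; move: (submK pq) => dE.
  set d := (mlead q - mlead p)%MM in dE *.
  have := mleadcM ('X_[d] : O) p.
  by rewrite mleadXm dE mcoeffX eqxx mul1r => ->; rewrite /a divfK.
have leqr : (mlead (q - r) <= mlead q)%O.
  apply: le_trans (mleadB_le _ _) _.
  rewrite leUx lexx /= /r -scalerAl.
  apply: le_trans (mleadZ_le _ _) _.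
  apply: le_trans (mleadM_le _ _) _.
  by rewrite mleadXm submK.
rewrite lt_neqAle leqr andbT; apply: contraNneq rq0 => e.
by rewrite -mleadc_eq0 e mcoeffB rE subrr.
Qed.

(** In a strict chain, choose in each [I i.+1] outside [I i] an element of least leading monomial.
    Dickson's lemma makes one of these divide a later one, and cancelling contradicts minimality. *)
Lemma mpoly_acc (I : nat -> ideal O) :
  (forall i, {subset I i <= I i.+1}) ->
  exists i, {subset I i.+1 <= I i}.
Proof.
move=> Iinc; apply: contrapT => /forallNP noI.
have sub i j : (i <= j)%N -> {subset I i <= I j}.
  move=> /subnKC<-; elim: (j - i)%N => [|l IHl] x xI; first by rewrite addn0.
  by rewrite addnS; apply/Iinc/IHl.
pose A i (x : O) := x \in I i.+1 /\ x \notin I i.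
have exp i : exists p : O, A i p /\ forall q, A i q -> ~ (mlead q < mlead p)%O.
  have [|p] := @mlead_minimal (A i); last by exists p.
  apply: contrapT => /forallNP nA; apply: (noI i) => x xI.
  by apply/negPn/negP => xnI; apply: (nA x).
have [p pP] := choice exp.
have [i [j [ij pij]]] := dickson (fun i => mlead (p i)).
have [[piI piN] _] := pP i; have [[pjI pjN] minj] := pP j.
have pi0 : p i != 0 by apply: contraNneq piN => ->; rewrite rpred0.
have [c cP] := mlead_cancel pi0 pij.
have cpI : c * p i \in I j by apply/ideal_absorb/(sub _ _ ij).
have qN : p j - c * p i \notin I j.
  by apply: contra pjN => /rpredD/(_ cpI); rewrite subrK.
case: cP => [q0|]; first by rewrite q0 rpred0 in qN.
by apply: minj; split=> //; rewrite rpredB ?(Iinc _ _ cpI).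
Qed.

Lemma mpoly_max_ideal (F : ideal O -> Prop) : (exists I, F I) ->
  exists2 I, F I & forall J, F J -> {subset I <= J} -> {subset J <= I}.
Proof.
move=> [I0 FI0]; apply: contrapT => noMax.
have step (I : {I | F I}) : exists J : {J | F J},
    {subset sval I <= sval J} /\ ~ {subset sval J <= sval I}.
  apply: contrapT => /forallNP noJ; apply: noMax; exists (sval I) => [|J FJ IJ].
    exact: svalP I.
  by apply: contrapT => JI; apply: (noJ (exist _ J FJ)).
have [f fP] := choice step.
pose c i := sval (iter i f (exist _ I0 FI0)).
have [i|i] := @mpoly_acc c; first exact: (fP _).1.
exact: (fP _).2.
Qed.

End Noetherian.

Section Colon.
Variable R : comPzRingType.

Definition colon_ideal (I : ideal R) y : {pred R} := fun x => x * y \in I.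

Lemma mem_colon_ideal I y x : (x \in colon_ideal I y) = (x * y \in I).
Proof. by []. Qed.

Fact colon_ideal_zero I y : 0 \in colon_ideal I y.
Proof. by rewrite mem_colon_ideal mul0r rpred0. Qed.
Fact colon_ideal_add I y :
  {in colon_ideal I y &, forall u v, u + v \in colon_ideal I y}.
Proof. by move=> u v; rewrite !mem_colon_ideal mulrDl; apply: rpredD. Qed.
Fact colon_ideal_mul I y a :
  {in colon_ideal I y, forall u, a * u \in colon_ideal I y}.
Proof. by move=> u; rewrite !mem_colon_ideal -mulrA; apply: ideal_absorb. Qed.
HB.instance Definition _ I y := isIdeal.Build R (colon_ideal I y)
  (@colon_ideal_zero I y) (@colon_ideal_add I y) (@colon_ideal_mul I y).

Lemma qproj_mul_eq0 (I : ideal R) x y :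
  qproj I x * qproj I y = 0 <-> x * y \in I.
Proof.
rewrite -rmorphM -(rmorph0 (qproj I)) -[X in X \in I]subr0.
by split=> /qprojP.
Qed.

End Colon.

(** A maximal annihilator among those of the nonzero multiples [a * y] modulo [g] is prime. It omits
    [a], since otherwise [(a * y) ^+ 2] would be in [g]. *)
Lemma radical_associated_prime (k : fieldType) n (g : ideal {mpoly k[n]}) a :
  radical_ideal g -> a \notin g ->
  exists2 P : ideal {mpoly k[n]}, associated_prime g P & a \notin P.
Proof.
move=> grad ag.
pose F (I : ideal {mpoly k[n]}) :=
  exists2 y, a * y \notin g & I = colon_ideal g (a * y) :> ideal _.
have [|_ [y ayg ->] maxy] := @mpoly_max_ideal k n F.
  by exists (colon_ideal g (a * 1) : ideal _), 1; rewrite ?mulr1.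
exists (colon_ideal g (a * y) : ideal _); last first.
  rewrite mem_colon_ideal; apply: contra ayg => aayg.
  apply: (@grad _ 2); have -> : (a * y) ^+ 2 = y * (a * (a * y)) by ring.
  exact: ideal_absorb.
split; last first.
  by exists (qproj g (a * y)) => x; rewrite qproj_mul_eq0 mem_colon_ideal.
split=> [|u v]; first by rewrite mem_colon_ideal mul1r.
move=> uv; case: (boolP (u \in colon_ideal g (a * y))) => //= ug.
rewrite mem_colon_ideal in ug; rewrite mem_colon_ideal in uv.
apply: (maxy (colon_ideal g (a * (y * u)) : ideal _)).
- exists (y * u) => //; by have -> : a * (y * u) = u * (a * y) by ring.
- move=> x; rewrite !mem_colon_ideal => xg.
  have -> : x * (a * (y * u)) = u * (x * (a * y)) by ring.
  exact: ideal_absorb.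
rewrite mem_colon_ideal.
by have -> : v * (a * (y * u)) = u * v * (a * y) by ring.
Qed.

(** * Localization of a quotient ring *)

Section QuotientLocalization.
Variables (R : comPzRingType) (h P : ideal R).
Hypotheses (Pp : prime_ideal P) (hP : {subset h <= P}).
Local Notation Pbar := (quot_ideal h P : ideal (quot_ring h)).

Lemma mem_quot_ideal (I : ideal R) x : {subset h <= I} ->
  (qproj h x \in quot_ideal h I) = (x \in I).
Proof.
move=> hI; apply/asboolP/idP => [[y yI /qprojP/hI]|xI]; last by exists x.
by move=> /rpredD/(_ yI); rewrite subrK.
Qed.

Lemma quot_prime : prime_ideal Pbar.
Proof.
split=> [|x y]; first by rewrite -(rmorph1 (qproj h)) mem_quot_ideal ?Pp.1.
rewrite -[x]qprojK -[y]qprojK -rmorphM !mem_quot_ideal //.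
exact: Pp.2.
Qed.

Lemma quot_denomP d : denominator (fun y => y \notin Pbar) d ->
  exists2 s, s \notin P & d = qproj h s.
Proof.
move=> /(prime_ideal_denom quot_prime); rewrite -[d]qprojK mem_quot_ideal //.
by exists (repr d).
Qed.

Definition loc_img x : loc_at Pbar := loc_map_at Pbar (qproj h x).

Lemma loc_imgM x y : loc_img (x * y) = loc_img x * loc_img y.
Proof. by rewrite [RHS]loc_mulE /loc_img rmorphM; apply: loc_frac_eq; ring. Qed.

Lemma loc_imgD x y : loc_img (x + y) = loc_img x + loc_img y.
Proof. by rewrite [RHS]loc_addE /loc_img rmorphD; apply: loc_frac_eq; ring. Qed.

Lemma loc_img_eq0 x : x \in h -> loc_img x = 0.
Proof.
move=> xh; rewrite /loc_img (_ : qproj h x = 0) //.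
by rewrite -(rmorph0 (qproj h)); apply/qprojP; rewrite subr0.
Qed.

Lemma loc_img_inv s : s \notin P -> exists w, w * loc_img s = 1.
Proof.
move=> sP; have sD : denominator (fun y => y \notin Pbar) (qproj h s).
  by apply: denominator_mem; rewrite mem_quot_ideal.
exists (loc_frac 1 sD); rewrite [LHS]loc_mulE.
by apply: loc_frac_eq; ring.
Qed.

(** Contracting an extended ideal gives [sat P I]; local conditions on the quotient ring thus become
    conditions in [R]. *)
Lemma loc_ideal_imgP (I : ideal R) x : {subset h <= I} ->
  loc_img x \in loc_ideal_at Pbar (quot_ideal h I) <-> x \in sat P I.
Proof.
move=> hI; split=> [/asboolP[a [d [dD [aI]]]]|/(mem_satP _ _ Pp)[s sP sxI]].
  move=> /loc_fracP[u /quot_denomP[u' u'P ->]].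
  have [d' d'P ->] := quot_denomP dD.
  rewrite mulr1 -[a]qprojK -rmorphM -rmorphB -rmorphM -(rmorph0 (qproj h)).
  move=> /qprojP; rewrite subr0 => /hI e.
  rewrite -[a]qprojK mem_quot_ideal // in aI.
  apply: (@sat_intro _ _ _ (u' * d')).
    by apply/negP => /(Pp.2)/orP[]; apply/negP.
  have -> : u' * d' * x = u' * (x * d' - repr a) + u' * repr a by ring.
  by rewrite rpredD // ideal_absorb.
have sD : denominator (fun y => y \notin Pbar) (qproj h s).
  by apply: denominator_mem; rewrite mem_quot_ideal.
apply/asboolP; exists (qproj h (s * x)), (qproj h s), sD; split.
  by rewrite mem_quot_ideal.
by apply: loc_frac_eq; rewrite rmorphM; ring.
Qed.

Lemma ideal_gen_imgP s x :
  loc_img x \in ideal_gen (map loc_img s) <->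
  x \in sat P (ideal_sum h (ideal_gen s)).
Proof.
split=> [xs|/(mem_satP _ _ Pp)[d dP /asboolP[u [y [uh ys e]]]]].
  apply/loc_ideal_imgP; first exact: mem_ideal_suml.
  move: (loc_img x) xs; apply: ideal_gen_sub => _ /mapP[f fs ->].
  apply/loc_ideal_imgP; first exact: mem_ideal_suml.
  by apply/sub_sat/mem_ideal_sumr/mem_ideal_gen.
have [w wd] := loc_img_inv dP.
have -> : loc_img x = w * loc_img y.
  rewrite -[LHS]mul1r -wd -mulrA -loc_imgM e loc_imgD loc_img_eq0 //.
  by rewrite add0r.
apply: ideal_absorb; move: y ys {e}; apply: ideal_span_ind => [|y z|a y|a a_s].
- by rewrite loc_img_eq0 ?rpred0.
- by rewrite loc_imgD; apply: rpredD.
- by rewrite loc_imgM; apply: ideal_absorb.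
by apply: mem_ideal_gen; apply: map_f.
Qed.

Lemma regular_sequence_at gs :
  regular_sequence (map loc_img gs) -> regular_at P h gs.
Proof.
move=> [reg _] i igs x xgs; apply/ideal_gen_imgP; rewrite map_take.
have := reg i; rewrite size_map => /(_ igs (qproj _ (loc_img x))).
rewrite qproj_mul_eq0 (nth_map 0) // -loc_imgM -map_take mulrC => reg_i.
have /reg_i : loc_img (x * gs`_i) \in ideal_gen (map loc_img (take i gs)).
  exact/ideal_gen_imgP.
by rewrite -(rmorph0 (qproj _)) => /qprojP; rewrite subr0.
Qed.

End QuotientLocalization.

(** * The two inclusions for the primitive ideal *)

Theorem proposition6 (k : fieldType) (m : nat) (h g J : ideal {mpoly k[m]})
    (gs : seq {mpoly k[m]}) (t : nat)
    (k_char0 : [pchar k] =i pred0)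
    (h_sub_g : {subset h <= g})
    (h_unmixed : unmixed h)
    (g_radical : radical_ideal g)
    (g_ci : complete_intersection g)
    (J_jacobian : is_jacobian_ideal h J)
    (J_not_sub : forall P : ideal {mpoly k[m]},
       minimal_prime g P -> ~ {subset J <= P})
    (gs_min : minimal_generating_set gs g)
    (t_le : (t <= size gs)%N)
    (gs_torsion : forall f (f_gs : f \in take t gs),
       torsion (conormal_class h (minimal_generating_set_sub gs_min
                                    (mem_take f_gs))))
    (gs_local : forall P : ideal {mpoly k[m]}, associated_prime g P ->
       let Pbar : ideal (quot_ring h) := quot_ideal h P in
       let imgs : seq (loc_at Pbar) :=
         [seq loc_map_at Pbar (qproj h f) | f <- drop t gs] in
       regular_sequence imgs /\
       generating_set imgs (loc_ideal_at Pbar (quot_ideal h g))) :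
  primitive_ideal h g =i
    ideal_sum (ideal_gen (take t gs))
              (ideal_prod (ideal_gen (drop t gs)) (ideal_gen (drop t gs))).
Proof.
have [_ gs_g _] := gs_min; have [p [fs [_ fsh _]]] := J_jacobian.
have gs_sub : {subset gs <= g} by exact: minimal_generating_set_sub gs_min.
have dg : {subset ideal_gen (drop t gs) <= g}.
  by apply: ideal_gen_sub => x /mem_drop/gs_sub.
have g_split :
    {subset g <= ideal_sum (ideal_gen (take t gs)) (ideal_gen (drop t gs))}.
  move=> x; rewrite -gs_g -{1}(cat_take_drop t gs).
  move: x; apply: ideal_gen_sub => x; rewrite mem_cat => /orP[] xs.
    by apply/mem_ideal_suml/mem_ideal_gen.
  by apply/mem_ideal_sumr/mem_ideal_gen.
(* Torsion means [b * f = u + v] with [u] in the square of [g], [v] in [h] and [b] a nonzerodivisor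
   modulo [g]. Applying [xi] puts [b * xi f] in [g], and [b] cancels. *)
have torsion_sub : {subset ideal_gen (take t gs) <= primitive_ideal h g}.
  apply: ideal_gen_sub => f f_gs; apply/asboolP.
  split=> [|xi [xiD xih]]; first exact/gs_sub/(mem_take f_gs).
  have [a a_reg] := gs_torsion f f_gs.
  rewrite -[a]qprojK => /(congr1 val); rewrite val_conormal_scale /=.
  move: (repr a) (qprojK a) => b ab; rewrite -ab in a_reg.
  move=> /qproj_mul_eq0/asboolP[u [v [u_gg vh e]]].
  have [_ u_xi] : u \in g /\ xi u \in g.
    move: u u_gg {e}; apply: ideal_span_ind => [|x y [xg ?] [yg ?]|c x [xg ?]|].
    - by rewrite linear0 rpred0.
    - by rewrite linearD !rpredD.
    - split; first exact: ideal_absorb.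
      rewrite xiD; apply: rpredD; first exact: ideal_absorb.
      exact: ideal_absorbr.
    move=> _ [x [y [xg yg ->]]]; rewrite xiD; split; first exact: ideal_absorb.
    by apply: rpredD; apply: ideal_absorbr.
  have fg : f \in g by apply/gs_sub/(mem_take f_gs).
  have b_xi : b * xi f \in g.
    have -> : b * xi f = xi u + xi v - f * xi b.
      by rewrite -linearD -e xiD addrK.
    apply: rpredB; last exact: ideal_absorbr.
    by apply: rpredD => //; apply/h_sub_g/xih.
  have := a_reg (qproj g (xi f)); rewrite qproj_mul_eq0 => /(_ b_xi).
  by rewrite -(rmorph0 (qproj g)) => /qprojP; rewrite subr0.
have sq_sub : {subset ideal_prod (ideal_gen (drop t gs)) (ideal_gen (drop t gs))
    <= primitive_ideal h g}.
  apply: ideal_prod_sub => x y /dg xg /dg yg; apply/asboolP.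
  split=> [|xi [xiD _]]; first exact: ideal_absorb.
  by rewrite xiD; apply: rpredD; apply: ideal_absorbr.
move=> f; apply/idP/idP => [f_prim|]; last exact: ideal_sum_sub.
have /asboolP[fg _] := f_prim.
have [c f_eq] : exists c : nat -> {mpoly k[m]},
    f = \sum_(i < size gs) c i * gs`_i.
  by apply/ideal_genP; rewrite gs_g.
pose a i := c (t + i)%N.
have {f_eq} [u u_gen f_eq] : exists2 u, u \in ideal_gen (take t gs) &
    f = u + \sum_(i < size (drop t gs)) a i * (drop t gs)`_i.
  exists (\sum_(i < t) c i * gs`_i).
    by apply/(ideal_gen_takeP _ t_le); exists c.
  have -> : f = \sum_(i < t + (size gs - t)) c i * gs`_i by rewrite subnKC.
  rewrite big_split_ord size_drop /=; congr (_ + _).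
  by apply: eq_bigr => i _; rewrite nth_drop.
(* Otherwise some associated prime [P] omits [a i], against the local result applied to [f - u],
   whose two terms are both in the primitive ideal. *)
have a_g i : (i < size (drop t gs))%N -> a i \in g.
  move=> i_lt; apply/negPn/negP => aig.
  have [P Pass] := radical_associated_prime g_radical aig.
  move/negP; apply; have [Pp [y yP]] := Pass.
  have gP : {subset g <= P}.
    move=> x xg; apply/yP; rewrite -[y]qprojK qproj_mul_eq0 mulrC.
    exact: ideal_absorb.
  have hP : {subset h <= P} by move=> x /h_sub_g/gP.
  have [/(regular_sequence_at Pp hP) gs_reg imgs_gen] := gs_local P Pass.
  have gsP : {subset drop t gs <= P} by move=> x /mem_drop/gs_sub/gP.
  (* As [g] is radical, it agrees with [P] locally: [repr y] multiplies [P] into [g], and it is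
     outside [P], since otherwise its square, hence itself, would be in [g]. *)
  have P_gen : {subset P <= sat P (ideal_sum h (ideal_gen (drop t gs)))}.
    move=> x xP; apply/(ideal_gen_imgP Pp hP); rewrite [_ \in _]imgs_gen.
    apply/(loc_ideal_imgP Pp hP) => //.
    move: xP => /yP; rewrite -[y]qprojK qproj_mul_eq0 => xyg.
    have yP' : repr y \notin P.
      apply/negP => /yP; rewrite -{2}[y]qprojK qproj_mul_eq0 => yyg.
      have /g_radical : repr y ^+ 2 \in g by rewrite expr2.
      rewrite -[repr y]subr0 => /qprojP; rewrite qprojK rmorph0 => y0.
      by move/negP: Pp.1; apply; apply/yP; rewrite y0 mulr0.
    by apply: (sat_intro yP'); rewrite mulrC.
  apply: (derivation_detects_coef k_char0 Pp hP gsP fsh gs_reg P_gen) i_lt.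
  move=> xi xiD.
  have -> : \sum_(j < size (drop t gs)) a j * (drop t gs)`_j = f - u.
    by rewrite f_eq addrC addKr.
  have /asboolP[_] := torsion_sub _ u_gen; have /asboolP[_] := f_prim.
  move=> /(_ xi xiD) fxi /(_ xi xiD) uxi.
  by rewrite linearB; apply/gP/rpredB.
(* Each [a i] is in [g]; its part in [(g_1, ..., g_t)] stays there after multiplication, and its
   other part times the generator is a product of two elements of [ideal_gen (drop t gs)]. *)
rewrite f_eq rpredD //; first exact: mem_ideal_suml.
apply: rpred_sum => i _; have := a_g i (ltn_ord i).
have di : (drop t gs)`_i \in ideal_gen (drop t gs).
  by apply: mem_ideal_gen; apply: mem_nth.
move=> /g_split/asboolP[v [w [v_t w_d ->]]].
rewrite mulrDl rpredD //.
  by rewrite mulrC; apply/mem_ideal_suml/ideal_absorb.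
by apply/mem_ideal_sumr/mem_ideal_prod.
Qed.
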